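(* Let $(V,\mu)$ be a separable probability space, and let $\mathcal{M}$ be the set of self-adjoint kernel operators $M:V\times V\to\mathbb{C}$ with $\|M\|_\infty\le 1$. Let $\{M_i\}_{i=1}^\infty$ be a sequence in $\mathcal{M}$. Then the following two statements are equivalent. 1. $\{M_i\}_{i=1}^\infty$ is convergent in the cut norm. 2. There is a decreasing sequence $\{\alpha_j\}_{j=1}^\infty$ of positive reals with $\lim_{j\to\infty}\alpha_j=0$ such that for every $j$ the sequence $\{[M_i]_{\alpha_j}\}_{i=1}^\infty$ is convergent in $L_2(V\times V)$. Furthermore, in the situation of statement 2, the cut norm limit $M$ of $\{M_i\}_{i=1}^\infty$ can be computed as $$M=\lim_{j\to\infty}\Bigl(\lim_{i\to\infty}[M_i]_{\alpha_j}\Bigr),$$ with convergence in $L_2$.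
   Context: A (Hilbert–Schmidt) kernel operator is a complex-valued function $M\in L_2(V\times V,\mu\times\mu)$ (up to a.e. equality), acting on $L_2(V,\mu)$ by $(Mf)(x)=\int M(x,y)f(y)\,d\mu(y)$. It is self-adjoint if $M(x,y)=\overline{M(y,x)}$ a.e. $\|M\|_2,\|M\|_\infty$ are the norms of $M$ as a function on $V\times V$. The cut norm is $\|M\|_\square=\sup|f^*Mg|$, the supremum over measurable $f,g:V\to\mathbb{C}$ with $\|f\|_\infty,\|g\|_\infty\le 1$, where $f^*Mg=\iint\overline{f(x)}M(x,y)g(y)\,d\mu(x)\,d\mu(y)$. A self-adjoint $M$ has a spectral decomposition $M=\sum_i\lambda_i f_if_i^*$ (convergent in $L_2$) with $\{f_i\}$ orthonormal in $L_2(V)$ and $\lambda_i\in\mathbb{R}$, where $(ff^* )(x,y)=f(x)\overline{f(y)}$. For $\lambda\ge 0$, $[M]_\lambda=\sum_{i:\,|\lambda_i|>\lambda}\lambda_i f_if_i^*$ (independent of the choice of $f_i$). *)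

(* Defs.v *)
(* MathComp-Analysis, with the complex numbers R[i] of mathcomp-real-closed. *)
From HB Require Import structures.
From mathcomp Require Import all_boot all_order all_algebra.
From mathcomp Require Import complex.
From mathcomp Require Import all_classical all_reals all_analysis.

Set Implicit Arguments.
Unset Strict Implicit.
Unset Printing Implicit Defensive.

Import Order.TTheory GRing.Theory Num.Theory.
Import numFieldNormedType.Exports.

Local Open Scope classical_set_scope.
Local Open Scope ring_scope.

(* The modulus of a complex number, as an element of R. *)
Notation modulus := ComplexField.Normc.normc.

Section complex_functions.
Context d (T : measurableType d) (R : realType).
Implicit Types (mu : {measure set T -> \bar R}) (f g : T -> R[i]).

(* R[i] carries no sigma-algebra in the library: measurability and integration
   are componentwise. *)
Definition cmeasurable f : Prop :=
  measurable_fun [set: T] (fun x => complex.Re (f x)) /\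
  measurable_fun [set: T] (fun x => complex.Im (f x)).

Definition cintegral mu f : R[i] :=
  Complex (Rintegral mu [set: T] (fun x => complex.Re (f x)))
          (Rintegral mu [set: T] (fun x => complex.Im (f x))).

Definition cLnorm mu (p : \bar R) f : \bar R :=
  Lnorm mu p (fun x => (modulus (f x))%:E).

(* Elements of L_2 and kernels are represented by functions; every notion below
   is invariant under almost everywhere equality. *)
Definition inL2 mu f : Prop :=
  cmeasurable f /\ (cLnorm mu 2%:E f < +oo)%E.

Definition L2cvg mu (F : nat -> T -> R[i]) (g : T -> R[i]) : Prop :=
  inL2 mu g /\
  cLnorm mu 2%:E (fun x => F n x - g x) @[n --> \oo] --> 0%E.

Definition inner mu f g : R[i] :=
  cintegral mu (fun x => conjc (f x) * g x).

(* An orthonormal family indexed by a finite or countable set I of naturals. *)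
Definition orthonormal mu (I : pred nat) (f : nat -> T -> R[i]) : Prop :=
  (forall k, I k -> inL2 mu (f k)) /\
  (forall k l, I k -> I l -> inner mu (f k) (f l) = (k == l)%:R).

(* Separability of the measure algebra for the distance mu (A `+` B), that is,
   of (T, mu) as a measure space. *)
Definition separable_measure mu : Prop :=
  exists A : nat -> set T, (forall n, measurable (A n)) /\
    forall B, measurable B -> forall e : R, 0 < e ->
      exists n, (mu (B `+` A n) < e%:E)%E.

End complex_functions.

Section kernels.
Context d (V : measurableType d) (R : realType) (mu : probability V R).
Implicit Types (M N K : V * V -> R[i]).

Definition hs_kernel M : Prop := inL2 (mu \x mu)%E M.

Definition self_adjoint M : Prop :=
  {ae (mu \x mu)%E, forall z, M z = conjc (M (z.2, z.1))}.

Definition unit_self_adjoint_kernel M : Prop :=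
  [/\ hs_kernel M, self_adjoint M & (cLnorm (mu \x mu)%E +oo%E M <= 1)%E].

(* f^* M g *)
Definition sesqui (f : V -> R[i]) M (g : V -> R[i]) : R[i] :=
  cintegral (mu \x mu)%E (fun z => conjc (f z.1) * M z * g z.2).

Definition cut_norm M : \bar R :=
  ereal_sup [set r | exists f g : V -> R[i],
    [/\ cmeasurable f, cmeasurable g,
        (cLnorm mu +oo%E f <= 1)%E, (cLnorm mu +oo%E g <= 1)%E &
        r = (modulus (sesqui f M g))%:E]].

Definition cut_cvg (M : nat -> V * V -> R[i]) K : Prop :=
  hs_kernel K /\ cut_norm (fun z => M n z - K z) @[n --> \oo] --> 0%E.

(* The sum of lam_k f_k f_k^* over the k < n with P k. *)
Definition spectral_sum (P : pred nat) (lam : nat -> R)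
    (f : nat -> V -> R[i]) (n : nat) : V * V -> R[i] :=
  fun z => \sum_(k < n | P k) (Complex (lam k) 0) * (f k z.1 * conjc (f k z.2)).

Definition spectral_decomposition M (I : pred nat) (lam : nat -> R)
    (f : nat -> V -> R[i]) : Prop :=
  orthonormal mu I f /\ L2cvg (mu \x mu)%E (spectral_sum I lam f) M.

Definition is_truncation M (a : R) N : Prop :=
  exists (I : pred nat) (lam : nat -> R) (f : nat -> V -> R[i]),
    spectral_decomposition M I lam f /\
    L2cvg (mu \x mu)%E
      (spectral_sum (fun k => I k && (a < `|lam k|)) lam f) N.

(* [M]_a: for a self-adjoint kernel M and a >= 0, a truncation exists by the
   spectral theorem and is unique up to almost everywhere equality; xget selects
   a representative (its default value 0 is irrelevant there). *)
Definition truncation M (a : R) : V * V -> R[i] :=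
  xget (fun=> 0) [set N | is_truncation M a N].

End kernels.

(* [decreasing_seq] is the strict notion. *)
Definition thresholds (R : realType) (alpha : nat -> R) : Prop :=
  [/\ decreasing_seq alpha, forall j, 0 < alpha j & alpha @ \oo --> (0 : R)].

(* Main.v *)
(* For kernels bounded by a constant, the cut norm and the operator norm define the
   same convergence: splitting [f] and [g] at height [L] bounds [f^* M g] by
   [L ^ 2] times the cut norm plus a multiple of [1 / L].

   If the truncations converge, then [M - [M]_a] has operator norm at most [a], so
   the sequence is Cauchy for the operator norm; moreover [[M]_a - [M]_b] is
   orthogonal to [[M]_b] for [a <= b], so the squared norms of the limits [N j]
   increase and stay bounded by [1], and [N] converges in [L_2].

   Conversely, let [K] be the limit in operator norm and choose the thresholds away
   from the absolute values of the eigenvalues of [K].  If [K] has no spectrum at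
   distance less than [d] from [a] or [- a], then by the Davis-Kahan argument the
   eigenvectors of [M i] with eigenvalue above [a] are close to the corresponding
   eigenspaces of [K], and vice versa; as there are at most [1 / a ^ 2] of them,
   the truncations converge in Hilbert-Schmidt norm. *)
Require Import Defs.
From HB Require Import structures.
From mathcomp Require Import all_boot all_order all_algebra.
From mathcomp Require Import complex.
From mathcomp Require Import all_classical all_reals all_analysis.
From mathcomp Require Import measurable_realfun ess_sup_inf.
From mathcomp Require Import ring lra.

Set Implicit Arguments.
Unset Strict Implicit.
Unset Printing Implicit Defensive.

Import Order.TTheory GRing.Theory Num.Theory.
Import numFieldNormedType.Exports.

Local Open Scope classical_set_scope.
Local Open Scope ring_scope.

(** Square integrable functions are not divided by almost everywhere equality: equality of vectors
    is replaced by [nrm (x - y) = 0], and identities between operators are stated through the forms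
    [sform]. The spectral theorem is proved in this setting, because it is what makes [truncation]
    meaningful.

    The eigenvectors of [M i] and of the limit cannot be matched one by one, since eigenvalues may
    be multiple or cross. No eigenvector is therefore shown to converge. Instead, the squared
    distance of two truncations is written exactly in terms of the overlaps of the two eigenvector
    families, and each piece is at most the squared operator distance times a constant depending on
    the threshold, the gap and the Hilbert-Schmidt norms.

    The cut norm limit [K] is only known to be square integrable, so the splitting at height [L]
    does not apply to [M i - K]. It is applied to [M i - M j], which is bounded by 2; then [j] goes
    to infinity against bounded test functions. *)

Section modulus.
Context {R : realType}.
Implicit Types (c z : R[i]) (x y : R).

Definition rc x : R[i] := Complex x 0.

Lemma sqr_modulus c : modulus c ^+ 2 = complex.Re c ^+ 2 + complex.Im c ^+ 2.
Proof. by case: c => a b /=; rewrite sqr_sqrtr// addr_ge0// sqr_ge0. Qed.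

Lemma modulus_ge0 c : 0 <= modulus c.
Proof. by case: c => a b /=; exact: sqrtr_ge0. Qed.

Lemma mulJc c : conjc c * c = rc (modulus c ^+ 2).
Proof.
rewrite sqr_modulus; case: c => a b; apply/eqP; rewrite eq_complex/=.
by apply/andP; split; apply/eqP; ring.
Qed.

Lemma mulcJ c : c * conjc c = rc (modulus c ^+ 2).
Proof. by rewrite mulrC mulJc. Qed.

Lemma modulusJ c : modulus (conjc c) = modulus c.
Proof. by case: c => a b /=; rewrite sqrrN. Qed.

Lemma modulus_rc x : modulus (rc x) = `|x|.
Proof. by rewrite /= expr0n/= addr0 sqrtr_sqr. Qed.

Lemma normr_Re_le c : `|complex.Re c| <= modulus c.
Proof.
rewrite -(@ler_pXn2r _ 2)// ?nnegrE ?modulus_ge0// sqr_modulus real_normK ?num_real//.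
by rewrite lerDl sqr_ge0.
Qed.

Lemma Re_le_modulus c : complex.Re c <= modulus c.
Proof. exact: le_trans (ler_norm _) (normr_Re_le c). Qed.

Lemma normr_Im_le c : `|complex.Im c| <= modulus c.
Proof.
rewrite -(@ler_pXn2r _ 2)// ?nnegrE ?modulus_ge0// sqr_modulus real_normK ?num_real//.
by rewrite lerDr sqr_ge0.
Qed.

Lemma modulus_eq0 c : modulus c = 0 -> c = 0.
Proof. exact: ComplexField.Normc.eq0_normc. Qed.

Lemma modulusD c z : modulus (c + z) <= modulus c + modulus z.
Proof. exact: le_normcD. Qed.

Lemma modulusN c : modulus (- c) = modulus c.
Proof. exact: normcN. Qed.

Lemma modulusM c z : modulus (c * z) = modulus c * modulus z.
Proof. exact: ComplexField.Normc.normcM. Qed.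

Lemma modulus_le_ReIm c : modulus c <= `|complex.Re c| + `|complex.Im c|.
Proof.
rewrite -(@ler_pXn2r _ 2)// ?nnegrE ?modulus_ge0 ?addr_ge0// sqr_modulus.
rewrite sqrrD !real_normK ?num_real//.
by rewrite lerD2r lerDl mulrn_wge0// mulr_ge0.
Qed.

Lemma ReD c z : complex.Re (c + z) = complex.Re c + complex.Re z.
Proof. by case: c z => [? ?] []. Qed.

Lemma ReB c z : complex.Re (c - z) = complex.Re c - complex.Re z.
Proof. by case: c z => [? ?] []. Qed.

Lemma ReZ x c : complex.Re (rc x * c) = x * complex.Re c.
Proof. by case: c => a b /=; rewrite mul0r subr0. Qed.

Lemma rcB x y : rc (x - y) = rc x - rc y.
Proof. exact: (rmorphB (real_complex R)). Qed.

Lemma rcM x y : rc (x * y) = rc x * rc y.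
Proof. exact: (rmorphM (real_complex R)). Qed.

Lemma rc_sum (I : Type) (r : seq I) (P : pred I) (F : I -> R) :
  rc (\sum_(i <- r | P i) F i) = \sum_(i <- r | P i) rc (F i).
Proof. exact: (rmorph_sum (real_complex R)). Qed.

Lemma rcJ x : conjc (rc x) = rc x.
Proof. by rewrite /= oppr0. Qed.

Lemma rcN x : rc (- x) = - rc x.
Proof. exact: (rmorphN (real_complex R)). Qed.

Lemma rc1 : rc 1 = 1. Proof. by []. Qed.
Lemma rc0 : rc 0 = 0. Proof. by []. Qed.

End modulus.

(** * Real sequences tending to 0 *)

Section null_sequences.
Context {R : realType}.
Implicit Types (a b : nat -> R).

Definition null_seq a := a @ \oo --> (0 : R).

Lemma null_seqP a : null_seq a <->
  forall e : R, 0 < e -> exists N, forall n, (N <= n)%N -> `|a n| < e.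
Proof.
split.
  move=> /cvgrPdist_lt h e /h[N _ hN]; exists N => n Nn.
  by have := hN n Nn; rewrite sub0r normrN.
move=> h; apply/cvgrPdist_lt => e /h[N hN]; exists N => // n /= Nn.
by rewrite sub0r normrN; exact: hN.
Qed.

Lemma null_seq0 : null_seq (fun=> 0).
Proof. exact: cvg_cst. Qed.

Lemma null_seqD a b : null_seq a -> null_seq b -> null_seq (fun n => a n + b n).
Proof. by move=> ha hb; rewrite /null_seq -(addr0 0); exact: cvgD. Qed.

Lemma null_seq_sum (n : nat) (P : pred nat) (F : nat -> nat -> R) :
  (forall k, P k -> null_seq (F k)) ->
  null_seq (fun m => \sum_(k < n | P k) F k m).
Proof.
move=> h; elim: n => [|n ih].
  by under eq_fun do rewrite big_ord0; exact: null_seq0.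
have -> : (fun m => \sum_(k < n.+1 | P k) F k m) =
    (fun m => \sum_(k < n | P k) F k m + (if P n then F n m else 0)).
  by apply/funext => m; rewrite [LHS]big_mkcond big_ord_recr/=;
    congr (_ + _); rewrite [RHS]big_mkcond.
apply: null_seqD => //; have := h n; case: (P n) => [/(_ isT)//|_]; exact: null_seq0.
Qed.

Lemma null_seqZ x a : null_seq a -> null_seq (fun n => x * a n).
Proof. by move=> ha; rewrite /null_seq -(mulr0 x); exact: cvgMl_tmp. Qed.

Lemma null_seqZr x a : null_seq a -> null_seq (fun n => a n * x).
Proof. by move=> ha; rewrite /null_seq -(mul0r x); exact: cvgMr_tmp. Qed.

Lemma null_seq_le a b : (forall n, 0 <= a n <= b n) -> null_seq b -> null_seq a.
Proof.
move=> h hb; apply: (@squeeze_cvgr _ _ _ _ (fun=> 0) b) => //.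
- by near=> n; exact: h.
- exact: cvg_cst.
Unshelve. all: end_near. Qed.

Lemma null_seq_ge x b : (forall n, x <= b n) -> null_seq b -> x <= 0.
Proof.
move=> h hb; rewrite -(cvg_lim (@Rhausdorff R) hb).
by apply: limr_ge; [apply/cvg_ex; exists 0|near=> n; exact: h].
Unshelve. all: end_near. Qed.

Lemma null_seq_ge_near x b N : (forall n, (N <= n)%N -> x <= b n) ->
  null_seq b -> x <= 0.
Proof.
move=> h hb; apply: (@null_seq_ge x (fun n => b (n + N)%N)).
  by move=> n; apply: h; rewrite leq_addl.
by rewrite /null_seq (@cvg_shiftn N R b).
Qed.

Lemma null_seq_sqrt a : (forall n, 0 <= a n) -> null_seq a ->
  null_seq (fun n => Num.sqrt (a n)).
Proof.
move=> a0 /null_seqP h; apply/null_seqP => e e0.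
have [N hN] := h _ (exprn_gt0 2 e0); exists N => n /hN.
rewrite !ger0_norm ?sqrtr_ge0// => hlt.
by rewrite -(@ltr_pXn2r _ 2)// ?nnegrE ?sqrtr_ge0 ?(ltW e0)// sqr_sqrtr.
Qed.

Lemma null_seq_sqr a : null_seq a -> null_seq (fun n => a n ^+ 2).
Proof.
move=> h; rewrite /null_seq -(mulr0 0).
by under eq_fun do rewrite expr2; exact: cvgM.
Qed.

Lemma null_seq_harmonic : null_seq (fun n => n.+1%:R^-1).
Proof. exact: cvg_harmonic. Qed.

Lemma null_seq_dist a l : a @ \oo --> l -> null_seq (fun n => `|a n - l|).
Proof.
move=> /cvgrPdist_lt h; apply/null_seqP => e /h[N _ hN]; exists N => n Nn.
by rewrite normr_id distrC; exact: hN.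
Qed.

End null_sequences.

(** * Semi-Hilbert spaces *)

(* Only semi-definite: the model is square integrable functions, not classes of
   functions modulo almost everywhere equality. *)
Structure semiHilbert (R : realType) := SemiHilbert {
  hsort :> lmodType R[i];
  ip : hsort -> hsort -> R[i];
  ipDr : forall f g h, ip f (g + h) = ip f g + ip f h;
  ipZr : forall a f g, ip f (a *: g) = a * ip f g;
  ipC : forall f g, ip f g = conjc (ip g f);
  ip_ge0 : forall f, 0 <= complex.Re (ip f f);
  ip_complete : forall (u : nat -> hsort) (a : nat -> R), null_seq a ->
    (forall m n, complex.Re (ip (u m - u n) (u m - u n)) <= a m + a n) ->
    exists x, null_seq (fun n => complex.Re (ip (u n - x) (u n - x)))
}.
Arguments ip {R s}.

Section semi_hilbert.
Context {R : realType} {H : semiHilbert R}.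
Implicit Types (f g h x : H) (a b c : R[i]).

Definition sqn f : R := complex.Re (ip f f).
Definition nrm f : R := Num.sqrt (sqn f).

Lemma ipDl f g h : ip (f + g) h = ip f h + ip g h.
Proof. by rewrite ipC ipDr rmorphD/= -!ipC. Qed.

Lemma ipZl a f g : ip (a *: f) g = conjc a * ip f g.
Proof. by rewrite ipC ipZr rmorphM/= -ipC. Qed.

Lemma ip0r f : ip f 0 = 0.
Proof. by rewrite -(scale0r 0) ipZr mul0r. Qed.

Lemma ip0l f : ip 0 f = 0.
Proof. by rewrite ipC ip0r conjc0. Qed.

Lemma ipNr f g : ip f (- g) = - ip f g.
Proof. by rewrite -scaleN1r ipZr mulN1r. Qed.

Lemma ipBr f g h : ip f (g - h) = ip f g - ip f h.
Proof. by rewrite ipDr ipNr. Qed.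

Lemma ip_sumr (I : Type) (r : seq I) (P : pred I) (F : I -> H) f :
  ip f (\sum_(i <- r | P i) F i) = \sum_(i <- r | P i) ip f (F i).
Proof.
elim/big_rec2: _ => [|i y1 y2 Pi <-]; first exact: ip0r.
by rewrite ipDr.
Qed.

Lemma ip_suml (I : Type) (r : seq I) (P : pred I) (F : I -> H) f :
  ip (\sum_(i <- r | P i) F i) f = \sum_(i <- r | P i) ip (F i) f.
Proof.
elim/big_rec2: _ => [|i y1 y2 Pi <-]; first exact: ip0l.
by rewrite ipDl.
Qed.

Lemma ip_sqn f : ip f f = rc (sqn f).
Proof.
rewrite /sqn; have := ipC f f; case: (ip f f) => x y /= [/eqP].
rewrite -addr_eq0 -mulr2n mulrn_eq0/= => /eqP ->.
by [].
Qed.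

Lemma sqn_ge0 f : 0 <= sqn f.
Proof. exact: ip_ge0. Qed.

Lemma nrm_ge0 f : 0 <= nrm f.
Proof. exact: sqrtr_ge0. Qed.

Lemma sqr_nrm f : nrm f ^+ 2 = sqn f.
Proof. by rewrite sqr_sqrtr// sqn_ge0. Qed.

Lemma Re_ipC f g : complex.Re (ip f g) = complex.Re (ip g f).
Proof. by rewrite ipC; case: (ip g f). Qed.

Lemma sqnD f g : sqn (f + g) = sqn f + sqn g + 2 * complex.Re (ip f g).
Proof.
rewrite /sqn ipDl !ipDr !ReD (Re_ipC g f); ring.
Qed.

Lemma sqnZ a f : sqn (a *: f) = modulus a ^+ 2 * sqn f.
Proof. by rewrite /sqn ipZl ipZr mulrA mulJc ReZ. Qed.

Lemma sqnN f : sqn (- f) = sqn f.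
Proof. by rewrite -scaleN1r sqnZ modulusN modulus_rc normr1 expr1n mul1r. Qed.

Lemma sqnB f g : sqn (f - g) = sqn f + sqn g - 2 * complex.Re (ip f g).
Proof. by rewrite sqnD sqnN ipNr; congr (_ + _); case: (ip f g) => x y /=; ring. Qed.

Lemma sqnBC f g : sqn (f - g) = sqn (g - f).
Proof. by rewrite -sqnN opprB. Qed.

Lemma nrmZ a f : nrm (a *: f) = modulus a * nrm f.
Proof. by rewrite /nrm sqnZ sqrtrM ?sqr_ge0// sqrtr_sqr ger0_norm// modulus_ge0. Qed.

Lemma nrmN f : nrm (- f) = nrm f.
Proof. by rewrite /nrm sqnN. Qed.

Lemma nrmBC f g : nrm (f - g) = nrm (g - f).
Proof. by rewrite /nrm sqnBC. Qed.

(** The squared norm of [f - t <g, f> g], for real [t], is a nonnegative quadratic in [t]. The form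
    being only semi-definite, [sqn g = 0] is treated apart. *)
Lemma modulus_ip_sqr f g : modulus (ip f g) ^+ 2 <= sqn f * sqn g.
Proof.
set m := modulus (ip f g) ^+ 2.
have key (t : R) : 0 <= sqn f - 2 * t * m + t ^+ 2 * m * sqn g.
  have := sqn_ge0 (f - (rc t * ip g f) *: g).
  rewrite sqnB sqnZ ipZr modulusM modulus_rc exprMn.
  rewrite real_normK ?num_real// (ipC g f) modulusJ -/m.
  by rewrite -(mulrA (rc t)) mulJc -/m -rcM/=; congr (_ <= _); ring.
have m0 : 0 <= m by exact: sqr_ge0.
have [g0|g0] := ltP 0 (sqn g).
  have := key (sqn g)^-1.
  have -> : sqn f - 2 * (sqn g)^-1 * m + (sqn g)^-1 ^+ 2 * m * sqn g =
    (sqn f * sqn g - m) / sqn g by field; rewrite gt_eqF.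
  by rewrite pmulr_lge0 ?invr_gt0// subr_ge0.
have -> : sqn g = 0 by apply/eqP; rewrite eq_le g0 sqn_ge0.
rewrite mulr0 leNgt; apply/negP => mgt0.
have gE : sqn g = 0 by apply/eqP; rewrite eq_le g0 sqn_ge0.
(* For [sqn g = 0] the expression is affine in [t], and this [t] gives it the negative value
   [- sqn f - 2]. *)
have := key ((sqn f + 1) / m).
rewrite gE mulr0 addr0.
have -> : 2 * ((sqn f + 1) / m) * m = 2 * (sqn f + 1) by field; rewrite gt_eqF.
have := sqn_ge0 f; lra.
Qed.

Lemma modulus_ip f g : modulus (ip f g) <= nrm f * nrm g.
Proof.
rewrite -(@ler_pXn2r _ 2)// ?nnegrE ?modulus_ge0 ?mulr_ge0 ?nrm_ge0//.
by rewrite exprMn !sqr_nrm modulus_ip_sqr.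
Qed.

Lemma Re_ip_le f g : complex.Re (ip f g) <= nrm f * nrm g.
Proof. exact: le_trans (Re_le_modulus _) (modulus_ip f g). Qed.

Lemma nrmD f g : nrm (f + g) <= nrm f + nrm g.
Proof.
rewrite -(@ler_pXn2r _ 2)// ?nnegrE ?addr_ge0 ?nrm_ge0//.
rewrite sqr_nrm sqnD sqrrD !sqr_nrm; have := Re_ip_le f g; lra.
Qed.

Lemma nrmB f g : nrm (f - g) <= nrm f + nrm g.
Proof. by rewrite -(nrmN g) nrmD. Qed.

Lemma nrmB_trans x f g : nrm (f - g) <= nrm (f - x) + nrm (x - g).
Proof. by apply: le_trans (nrmD _ _); rewrite addrA subrK. Qed.

(** By Cauchy-Schwarz the form does not see vectors of norm 0. This is what allows [nrm (x - y) = 0]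
    to stand for equality of classes. *)
Lemma ip_nrm0 f g : nrm g = 0 -> ip f g = 0.
Proof.
move=> g0; apply: modulus_eq0; apply/eqP; rewrite eq_le modulus_ge0 andbT.
by rewrite (le_trans (modulus_ip _ _))// g0 mulr0.
Qed.

Definition hcvg (u : nat -> H) x := null_seq (fun n => nrm (u n - x)).

Lemma hcvg_sqn u x : null_seq (fun n => sqn (u n - x)) -> hcvg u x.
Proof. by apply: null_seq_sqrt => n; exact: sqn_ge0. Qed.

(** The Cauchy condition with a bound [a m + a n] for a single null sequence avoids limits in two
    indices. *)
Lemma complete u (a : nat -> R) : null_seq a ->
  (forall m n, sqn (u m - u n) <= a m + a n) -> exists x, hcvg u x.
Proof. by move=> a0 /(ip_complete a0)[x xP]; exists x; exact: hcvg_sqn. Qed.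

(** Passing through the limit of [q] bounds [|q n - q m|] by the sum of the distances of [q n] and
    [q m] to it. In the applications [q] is a monotone bounded sequence of squared norms. *)
Lemma complete_increments u (q : nat -> R) : cvgn q ->
  (forall m n, (m <= n)%N -> sqn (u n - u m) <= `|q n - q m|) ->
  exists x, hcvg u x.
Proof.
move=> /null_seq_dist q0 h; apply: (complete q0) => m n.
wlog mn : m n / (m <= n)%N.
  move=> hw; case: (leqP m n) => [/hw//|/ltnW/hw le].
  by rewrite sqnBC [leRHS]addrC.
rewrite sqnBC (le_trans (h _ _ mn))//.
by rewrite [leRHS]addrC (distrC (q m)) (le_trans _ (ler_normD _ _))// addrA subrK.
Qed.

Lemma hcvg_ipr u x f : hcvg u x -> null_seq (fun n => modulus (ip f (u n) - ip f x)).
Proof.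
move=> h; apply: (@null_seq_le _ _ (fun n => nrm f * nrm (u n - x))).
  by move=> n; rewrite modulus_ge0 -ipBr modulus_ip.
exact: null_seqZ.
Qed.

Lemma hcvg_ip_cst_near u x f c N : hcvg u x ->
  (forall n, (N <= n)%N -> ip f (u n) = c) -> ip f x = c.
Proof.
move=> /(hcvg_ipr f) h uc; apply/eqP; rewrite -subr_eq0 -(opprB c) oppr_eq0.
apply/eqP/modulus_eq0/eqP; rewrite eq_le modulus_ge0 andbT.
by apply: (@null_seq_ge_near _ _ _ N) h => n Nn; rewrite uc.
Qed.

Lemma hcvg_congr u x y : nrm (x - y) = 0 -> hcvg u x -> hcvg u y.
Proof.
move=> xy; apply: null_seq_le => n; rewrite nrm_ge0/=.
by rewrite (le_trans (nrmB_trans x _ _))// xy addr0.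
Qed.

Lemma hcvg_nrm u x : hcvg u x -> (fun n => nrm (u n)) @ \oo --> nrm x.
Proof.
move=> h; apply/cvgrPdist_le => e e0; near=> n.
apply: (@le_trans _ _ (nrm (u n - x))).
  rewrite ler_norml; apply/andP; split.
    rewrite lerNl opprB lerBlDr; have := nrmD (u n - x) x; by rewrite subrK.
  by rewrite lerBlDr nrmBC; have := nrmD (x - u n) (u n); rewrite subrK.
by near: n; move/null_seqP: h => /(_ _ e0)[N hN]; exists N => // n /= /hN;
  rewrite ger0_norm ?nrm_ge0// => /ltW.
Unshelve. all: end_near. Qed.

Definition ON (P : pred nat) (u : nat -> H) :=
  forall k l, P k -> P l -> ip (u k) (u l) = (k == l)%:R.

Lemma ip_ON_sum P u (c : nat -> R[i]) n l : ON P u -> P l -> (l < n)%N ->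
  ip (u l) (\sum_(k < n | P k) c k *: u k) = c l.
Proof.
move=> uP Pl ln; rewrite ip_sumr (bigD1 (Ordinal ln))//= big1 ?addr0.
  by rewrite ipZr uP// eqxx mulr1.
move=> k /andP[Pk kl]; rewrite ipZr uP//.
by rewrite eq_sym (negPf (_ : (k : nat) != l)) ?mulr0.
Qed.

Lemma sqn_ON_sum P u (c : nat -> R[i]) n : ON P u ->
  sqn (\sum_(k < n | P k) c k *: u k) = \sum_(k < n | P k) modulus (c k) ^+ 2.
Proof.
move=> uP; rewrite /sqn -[RHS]/(complex.Re (rc _)); congr (complex.Re _).
rewrite ip_suml; transitivity (\sum_(k < n | P k) rc (modulus (c k) ^+ 2)).
  by apply: eq_bigr => k Pk; rewrite ipZl (ip_ON_sum c uP Pk (ltn_ord k)) mulJc.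
by rewrite -rc_sum.
Qed.

Definition residual (P : pred nat) (u : nat -> H) n f :=
  f - \sum_(k < n | P k) ip (u k) f *: u k.

Lemma ip_residual P u n f l : ON P u -> P l -> (l < n)%N ->
  ip (u l) (residual P u n f) = 0.
Proof. by move=> uP Pl ln; rewrite ipBr (ip_ON_sum (fun k => ip (u k) f) uP Pl ln) subrr. Qed.

Lemma sqn_residual P u n f : ON P u ->
  sqn (residual P u n f) = sqn f - \sum_(k < n | P k) modulus (ip (u k) f) ^+ 2.
Proof.
move=> uP; rewrite sqnB (sqn_ON_sum (fun k => ip (u k) f) n uP).
have -> : ip f (\sum_(k < n | P k) ip (u k) f *: u k) =
    rc (\sum_(k < n | P k) modulus (ip (u k) f) ^+ 2).
  rewrite ip_sumr rc_sum; apply: eq_bigr => k _.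
  by rewrite ipZr (ipC f) mulcJ.
rewrite /=; ring.
Qed.

Lemma Bessel P u n f : ON P u ->
  \sum_(k < n | P k) modulus (ip (u k) f) ^+ 2 <= sqn f.
Proof. by move=> uP; rewrite -subr_ge0 -sqn_residual// sqn_ge0. Qed.

End semi_hilbert.

(** * Riesz representation by minimisation *)

Section riesz.
Context {R : realType} {H : semiHilbert R}.

Lemma parallelogram (f g : H) :
  sqn (f - g) = 2 * sqn f + 2 * sqn g - 4 * sqn (rc (2^-1) *: (f + g)).
Proof.
by rewrite sqnZ modulus_rc sqnB sqnD ger0_norm ?invr_ge0//; field.
Qed.

(** The discriminant criterion. For [y = 0] a nonzero [x] would let the affine function take the
    value -1. *)
Lemma sqr_le_of_quadratic (x y e : R) : 0 <= y ->
  (forall s, 0 <= s ^+ 2 * y + 2 * s * x + e) -> x ^+ 2 <= e * y.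
Proof.
move=> y0 h; have [ygt0|yle0] := ltP 0 y.
  have := h (- (x / y)).
  have -> : (- (x / y)) ^+ 2 * y + 2 * - (x / y) * x + e = (e * y - x ^+ 2) / y.
    by field; rewrite gt_eqF.
  by rewrite pmulr_lge0 ?invr_gt0// subr_ge0.
have yE : y = 0 by apply/eqP; rewrite eq_le yle0.
have [->|x0] := eqVneq x 0; first by rewrite expr0n/= yE mulr0.
have := h (- ((e + 1) / (2 * x))); rewrite yE mulr0 add0r.
have -> : 2 * - ((e + 1) / (2 * x)) * x + e = -1 by field.
by rewrite ler0N1.
Qed.

Lemma sqr_dist_le (x y z : R) : (x - z) ^+ 2 <= 2 * ((x - y) ^+ 2 + (y - z) ^+ 2).
Proof. by rewrite -subr_ge0; have := sqr_ge0 (x - y - (y - z)); nra. Qed.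

(** The functional [J g = |g|^2 - 2 Re (phi g)] is bounded below by [- c ^+ 2]. A minimising
    sequence is Cauchy by the parallelogram law, and the vanishing of the first variation at its
    limit is the representation. [phi] is conjugate linear because the form is so in its first
    argument. *)
Lemma Riesz (phi : H -> R[i]) (c : R) :
  (forall f g, phi (f + g) = phi f + phi g) ->
  (forall a f, phi (a *: f) = conjc a * phi f) ->
  (forall f, modulus (phi f) <= c * nrm f) ->
  exists h, forall f, ip f h = phi f.
Proof.
move=> phiD phiZ phib.
pose J (g : H) := sqn g - 2 * complex.Re (phi g).
pose E := range J.
have lbE : lbound E (- c ^+ 2).
  move=> _ [g _ <-]; rewrite /J -sqr_nrm.
  have := le_trans (Re_le_modulus _) (phib g); have := sqr_ge0 (nrm g - c).
  rewrite sqrrB; lra.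
have infE : has_inf E by split; [exists (J 0), 0|exists (- c ^+ 2)].
have near n : exists g : H, J g < inf E + n.+1%:R^-1.
  have [|_ [g _ <-] lt] := inf_adherent (_ : 0 < n.+1%:R^-1) infE.
    by rewrite invr_gt0.
  by exists g.
have [u uP] := choice near.
have geJ g : inf E <= J g by apply: ge_inf; [exact: infE.2|exists g].
have [||h uh] := complete (u := u) (a := fun n => 2 * n.+1%:R^-1).
- by apply: null_seqZ; exact: null_seq_harmonic.
- move=> m n; rewrite parallelogram.
  have := geJ (rc (2^-1) *: (u m + u n)); have := uP m; have := uP n.
  rewrite /J phiZ rcJ phiD ReZ ReD; move: (n.+1%:R^-1) (m.+1%:R^-1) (sqn _) => p q r; lra.
exists h => f.
have Ref g : complex.Re (ip g h) = complex.Re (phi g).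
  apply/eqP; rewrite -subr_eq0 -sqrf_eq0 eq_le sqr_ge0 andbT.
  (* [u n] minimises [J] up to [1 / (n + 1)], so moving from [u n] by [s g] gives a quadratic in [s]
     that is nonnegative after adding this error. *)
  have hn n : (complex.Re (ip g (u n)) - complex.Re (phi g)) ^+ 2 <= n.+1%:R^-1 * sqn g.
    apply: sqr_le_of_quadratic; first exact: sqn_ge0.
    move=> s; have := geJ (u n + rc s *: g); have := uP n.
    rewrite /J phiD phiZ rcJ sqnD sqnZ modulus_rc ipZr ReD !ReZ.
    rewrite real_normK ?num_real// (Re_ipC (u n)); move: (n.+1%:R^-1) => q; lra.
  apply: (@null_seq_ge _ _ (fun n => 2 * (modulus (ip g (u n) - ip g h) ^+ 2 +
      n.+1%:R^-1 * sqn g))) => [n|].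
    apply: le_trans (sqr_dist_le _ (complex.Re (ip g (u n))) _) _.
    rewrite ler_pM2l// lerD// -ReB -real_normK ?num_real//.
    rewrite -(modulusN (_ - ip g h)) opprB.
    by rewrite lerXn2r ?nnegrE ?modulus_ge0 ?normr_Re_le.
  apply: null_seqZ; apply: null_seqD.
    exact/null_seq_sqr/hcvg_ipr.
  by apply: null_seqZr; exact: null_seq_harmonic.
(* The real parts at ['i *: f] are the imaginary parts at [f], up to sign. *)
have := Ref f; have := Ref ('i%C *: f); rewrite ipZl phiZ.
case: (ip f h) => a b; case: (phi f) => p q /=.
rewrite !mul0r !mulN1r !sub0r !opprK => -> ->.
by [].
Qed.

End riesz.

(** * The spectral theorem *)

(* The power method: if no [A ^ (2 n) f] stayed away from [0], then a large power
   of [A] would have norm less than [1], since up to a small error [A] has finite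
   rank; a nonzero limit of [A ^ (2 n) f] is fixed by [A ^ 2]. *)
Section top_eigenvector.
Context {R : realType} {H : semiHilbert R} (A : H -> H).
Hypothesis Asym : forall f g, ip f (A g) = ip (A f) g.
Hypothesis Acontr : forall f, sqn (A f) <= sqn f.
Hypothesis AHS : exists C : R, forall n (e : nat -> H), ON (fun k => (k < n)%N) e ->
  \sum_(k < n) sqn (A (e k)) <= C.
Hypothesis Atop : forall d : R, 0 < d -> exists f, sqn f = 1 /\ 1 - d < sqn (A f).

Let s (f : H) n := sqn (iter n A f).

Let ip_iter n m f g : ip (iter n A f) (iter m A g) = ip (iter (m + n) A f) g.
Proof. by elim: m n => // m ih n; rewrite iterS Asym -iterS ih addnS. Qed.

Let ip_iter_double k f : ip (iter (k + k) A f) f = rc (s f k).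
Proof. by rewrite -ip_iter ip_sqn. Qed.

Let s_dec f m n : (m <= n)%N -> s f n <= s f m.
Proof.
move=> /subnK <-; elim: (n - m)%N => // k ih.
by rewrite addSn /s iterS (le_trans (Acontr _)).
Qed.

(** Cauchy-Schwarz for [A^k f] and [A^(k+2) f], whose scalar product is the squared norm of
    [A^(k+1) f] by symmetry. *)
Let s_logconvex f k : s f k.+1 ^+ 2 <= s f k * s f k.+2.
Proof.
apply: le_trans (modulus_ip_sqr _ _).
by rewrite ip_iter addSn -addnS ip_iter_double modulus_rc real_normK ?num_real.
Qed.

(** By log-convexity the ratios [s f n.+1 / s f n] do not decrease, so each is at least the first
    one, [sqn (A f)]. *)
Let s_geometric f n : sqn f = 1 -> 0 < sqn (A f) -> sqn (A f) ^+ n <= s f n.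
Proof.
move=> f1 Af0.
suff: 0 < s f n /\ sqn (A f) * s f n <= s f n.+1 /\ sqn (A f) ^+ n <= s f n by case=> _ [].
elim: n => [|n [sn [snn snle]]].
  by rewrite /s/= f1 mulr1 ltr01 expr0.
have sn1 : 0 < s f n.+1 by rewrite (lt_le_trans _ snn)// mulr_gt0.
split=> //; split.
  rewrite -(@ler_pM2l _ (s f n))// (le_trans _ (s_logconvex f n))//.
  by rewrite mulrA expr2 ler_pM2r// mulrC.
by rewrite exprS (le_trans _ snn)// ler_pM2l.
Qed.

(** [A] is a mere function, and its symmetry makes it linear only inside scalar products. *)
Let AZ c f g : ip g (A (c *: f)) = c * ip g (A f).
Proof. by rewrite Asym ipZr Asym. Qed.

Let sqnAZ c f : sqn (A (c *: f)) = modulus c ^+ 2 * sqn (A f).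
Proof.
rewrite /sqn AZ ipC AZ rmorphM/= mulrA mulcJ ip_sqn rcJ -rcM.
by [].
Qed.

(** Take a finite orthonormal family whose sum of [sqn (A (e k))] is within [d] of the supremum,
    finite by [AHS]. A unit vector orthogonal to the family can be appended, so it contributes at
    most [d]. *)
Lemma almost_finite_rank (d : R) : 0 < d ->
  exists n (e : nat -> H), ON (fun k => (k < n)%N) e /\
    forall f, (forall k, (k < n)%N -> ip (e k) f = 0) -> sqn (A f) <= d * sqn f.
Proof.
move=> d0; case: AHS => C CP.
pose E := [set x : R | exists n (e : nat -> H), ON (fun k => (k < n)%N) e /\
  x = \sum_(k < n) sqn (A (e k))].
have supE : has_sup E.
  split; first by exists 0, 0%N, (fun=> 0); split=> //; rewrite big_ord0.
  by exists C => _ [n [e [eON ->]]]; exact: CP.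
have [_ [n [e [eON ->]]] lt] := sup_adherent d0 supE.
exists n, e; split=> // f f_orth.
have [f0|fN0] := eqVneq (nrm f) 0.
  by rewrite (le_trans (Acontr f))// -sqr_nrm f0 expr0n/= mulr0.
pose c := rc ((nrm f)^-1).
pose e' k := if (k < n)%N then e k else c *: f.
have e'n : e' n = c *: f by rewrite /e' ltnn.
have e'lt k : (k < n)%N -> e' k = e k by rewrite /e' => ->.
have e'ON : ON (fun k => (k < n.+1)%N) e'.
  have orth k : (k < n)%N -> ip (e' k) (e' n) = 0.
    by move=> kn; rewrite e'n e'lt// ipZr f_orth// mulr0.
  move=> k l; rewrite /= (ltnS k) (ltnS l) (leq_eqVlt k) (leq_eqVlt l).
  move=> /predU1P[->|kn] /predU1P[->|ln].
  - rewrite eqxx e'n ipZl ipZr mulrA mulJc modulus_rc ip_sqn -rcM -sqr_nrm.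
    by rewrite ger0_norm ?invr_ge0 ?nrm_ge0// -exprMn mulVf// expr1n.
  - by rewrite ipC orth// conjc0 gtn_eqF.
  - by rewrite orth// ltn_eqF.
  - by rewrite !e'lt// eON.
have : \sum_(k < n.+1) sqn (A (e' k)) <= sup E.
  by apply: sup_ubound; [exact: supE.2|exists n.+1, e'].
rewrite big_ord_recr/= (eq_bigr (fun k : 'I_n => sqn (A (e k)))); last first.
  by move=> k _; rewrite e'lt.
rewrite e'n sqnAZ modulus_rc => le.
have {le lt} : `|(nrm f)^-1| ^+ 2 * sqn (A f) <= d by lra.
rewrite real_normK ?num_real// exprVn mulrC ler_pdivrMr ?sqr_nrm//.
by rewrite -sqr_nrm exprn_gt0// lt_neqAle eq_sym fN0 nrm_ge0.
Qed.

(** Otherwise every orbit tends to 0, in particular those of the finitely many vectors outside of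
    whose span [A] is small. Then [g = A^(N+1) f] has norm at most 1/2 for every unit [f] once [N]
    is large, whereas an [f] nearly attaining the norm 1 of [A] gives [sqn g >= 1/2]. *)
Lemma exists_persistent : exists f (d : R), 0 < d /\ forall n, d <= s f n.
Proof.
apply/not_existsP => hno.
have s_null f : null_seq (s f).
  apply/null_seqP => d d0; have := hno f; move/forallNP => /(_ d) /not_andP[//|].
  move=> /existsNP[N /negP]; rewrite -ltNge => lt; exists N => n Nn.
  by rewrite ger0_norm ?sqn_ge0// (le_lt_trans (s_dec f Nn)).
(* With this constant [A] has norm at most 1/4 on the orthogonal complement of the family. *)
have [|n0 [e [eON eP]]] := @almost_finite_rank (4^-1 ^+ 2); first by rewrite exprn_gt0.
have : null_seq (fun m => \sum_(k < n0 | xpredT k) nrm (iter m A (e k))).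
  apply: (@null_seq_sum _ n0 xpredT (fun k m => nrm (iter m A (e k)))) => k _.
  by apply: null_seq_sqrt; [move=> n; exact: sqn_ge0|exact: s_null].
move=> /null_seqP/(_ (4^-1))[//|N hN].
have {hN} := hN N.+1 (leqnSn N); rewrite ger0_norm ?sumr_ge0// => [hN|k _]; last exact: nrm_ge0.
(* By Bernoulli, [(1 - 1 / (2 (N + 1)))^(N + 1) >= 1/2]. *)
have d0 : (0 : R) < (2 * N.+1%:R)^-1 by rewrite invr_gt0 mulr_gt0.
have [f [f1 fA]] := Atop d0.
set g := iter N.+1 A f.
have g_big : 2^-1 <= sqn g.
  have dle : (2 * N.+1%:R)^-1 <= 2^-1 :> R.
    by rewrite lef_pV2 ?posrE ?mulr_gt0// ler_peMr// ler1n.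
  have Af0 : 0 < sqn (A f) by move: fA dle; set z := _^-1; lra.
  apply: le_trans (s_geometric N.+1 f1 Af0).
  apply: le_trans (_ : (1 - (2 * N.+1%:R)^-1) ^+ N.+1 <= _); last first.
    rewrite lerXn2r ?nnegrE ?sqn_ge0// ?(ltW fA)//.
    by move: dle; set z := (_ * _)^-1; lra.
  have bern m (x : R) : 0 <= x <= 1 -> 1 - x *+ m <= (1 - x) ^+ m.
    move=> x01; elim: m => [|m ih]; first by rewrite mulr0n subr0 expr0.
    rewrite exprS (le_trans _ (ler_wpM2l _ ih))//; last by lra.
    rewrite mulrS -[x *+ m]mulr_natl -subr_ge0.
    have -> : (1 - x) * (1 - m%:R * x) - (1 - (x + m%:R * x)) = m%:R * x ^+ 2 by ring.
    by rewrite mulr_ge0 ?sqr_ge0.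
  apply: le_trans (bern _ _ _); last by move: d0 dle; set z := (_ * _)^-1; lra.
  have -> : (2 * N.+1%:R)^-1 *+ N.+1 = 2^-1 :> R.
    by rewrite -[LHS]mulr_natl invfM mulrCA divff ?mulr1 ?pnatr_eq0.
  by lra.
have nf1 : nrm f = 1 by rewrite /nrm f1 sqrtr1.
have gle m h : nrm (iter m A h) <= nrm h.
  by rewrite ler_sqrt ?sqn_ge0//; exact: (@s_dec h 0 m).
pose r := residual (fun k => (k < n0)%N) e n0 f.
have fE : f = r + \sum_(k < n0 | (k < n0)%N) ip (e k) f *: e k by rewrite subrK.
have nAr : nrm (A r) <= 4^-1.
  rewrite -(@ler_pXn2r _ 2)// ?nnegrE ?nrm_ge0// sqr_nrm.
  rewrite (le_trans (eP r _))//; first by move=> k kn; exact: ip_residual.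
  rewrite ler_piMr ?exprn_ge0// sqn_residual// f1 gerBl sumr_ge0// => k _.
  exact: sqr_ge0.
(* [sqn g] is the scalar product of [A^(N+1) g] with [f], and [f] is [r] plus a combination of the
   [e k]. One factor [A] is moved onto [r], and all of [A^(N+1)] onto each [e k]; each part gives a
   quarter. *)
have : sqn g <= nrm g * (4^-1 + 4^-1).
  rewrite {1}/sqn {2}/g -[iter _ _ f]/(iter N.+1 A f) -[X in ip X _]/(iter 0 A g).
  rewrite ip_iter addn0 [X in ip _ X]fE ipDr ReD mulrDr.
  apply: lerD.
    rewrite iterS -Asym (le_trans (Re_ip_le _ _))// ler_pM ?nrm_ge0//.
  rewrite ip_sumr (le_trans (Re_le_modulus _))//.
  apply: (@le_trans _ _ (nrm g * \sum_(k < n0) nrm (iter N.+1 A (e k)))); last first.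
    by rewrite ler_wpM2l ?nrm_ge0// ltW.
  rewrite mulr_sumr (eq_bigl xpredT) => [|k]; last by rewrite ltn_ord.
  elim/big_ind2: _ => [|x1 x2 y1 y2 le1 le2|k _]; first by rewrite ComplexField.Normc.normc0.
    by rewrite (le_trans (modulusD _ _))// lerD.
  rewrite ipZr -[iter _ _ _]/(iter N.+1 A g) -(addn0 N.+1) -(ip_iter 0) modulusM.
  rewrite addn0 -[leRHS]mul1r ler_pM ?modulus_ge0//; last exact: modulus_ip.
  rewrite (le_trans (modulus_ip _ _))// nf1 mulr1 /nrm /sqn eON// eqxx.
  by rewrite sqrtr1.
rewrite -sqr_nrm => zz; move: g_big; rewrite -sqr_nrm leNgt => /negP; apply.
have z2 : nrm g <= 2^-1.
  rewrite leNgt; apply/negP => z2; have z0 := lt_trans (_ : 0 < 2^-1) z2.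
  by move: zz; rewrite expr2 ler_pM2l ?z0//; lra.
apply: (@le_lt_trans _ _ (2^-1 ^+ 2)); last by lra.
by rewrite lerXn2r ?nnegrE ?nrm_ge0.
Qed.

(** Even powers are used because an eigenvalue -1 makes the full orbit oscillate. The limit [x]
    satisfies [A (A x) = x], that is, [A - 1] annihilates [A x + x], and either this vector or [x]
    itself is an eigenvector. *)
Lemma top_eigenvector : exists e (l : R), [/\ `|l| = 1, nrm e = 1 &
  forall f, ip f (A e) = rc l * ip f e].
Proof.
have [f [d [d0 dP]]] := exists_persistent.
have [||x xP] := @complete_increments _ _ (fun n => iter n.*2 A f) (fun n => s f n.*2).
- apply: nonincreasing_is_cvgn.
    by move=> m n mn; apply: s_dec; rewrite leq_double.
  by exists 0 => _ [n _ <-]; exact: sqn_ge0.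
(* The squared distance is [s f (2 n) + s f (2 m) - 2 s f (m + n)], and [s f (m + n) >= s f (2 n)]
   because [m + n <= 2 n]. *)
- move=> m n mn; rewrite sqnB ip_iter -doubleD -(addnn (m + n)) ip_iter_double/=.
  rewrite -[sqn _]/(s f n.*2) -[sqn (iter m.*2 _ _)]/(s f m.*2).
  rewrite ler0_norm ?subr_le0 ?s_dec ?leq_double//.
  have : s f n.*2 <= s f (m + n) by apply: s_dec; rewrite -addnn leq_add2r.
  lra.
have xN0 : nrm x != 0.
  apply/eqP => x0; suff : Num.sqrt d <= 0 by rewrite leNgt sqrtr_gt0 d0.
  apply: null_seq_ge xP => n; apply: (@le_trans _ _ (nrm (iter n.*2 A f))).
    by rewrite ler_sqrt ?dP ?sqn_ge0.
  by have := nrmD (iter n.*2 A f - x) x; rewrite subrK x0 addr0.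
have AAx h : ip h (A (A x)) = ip h x.
  apply/eqP; rewrite -subr_eq0; apply/eqP/modulus_eq0/eqP.
  rewrite eq_le modulus_ge0 andbT !Asym.
  have h1 := hcvg_ipr (A (A h)) xP; have h2 := hcvg_ipr h xP.
  have {}h2 : null_seq (fun n => modulus (ip h (iter n.+1.*2 A f) - ip h x)).
    by move: h2; rewrite /null_seq -(cvg_shiftS (fun n => modulus (ip h (iter n.*2 A f) - ip h x))).
  apply: null_seq_ge (null_seqD h1 h2) => n.
  rewrite doubleS !iterS !Asym; set a := ip _ (iter _ _ _).
  have -> : ip (A (A h)) x - ip h x = - (a - ip (A (A h)) x) + (a - ip h x) by ring.
  by rewrite (le_trans (modulusD _ _))// modulusN.
have normalize y (l : R) : `|l| = 1 -> nrm y != 0 ->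
    (forall h, ip h (A y) = rc l * ip h y) ->
    exists e (l : R), [/\ `|l| = 1, nrm e = 1 & forall f, ip f (A e) = rc l * ip f e].
  move=> l1 y0 yP; exists (rc ((nrm y)^-1) *: y), l; split=> // [|h].
    by rewrite nrmZ modulus_rc ger0_norm ?invr_ge0 ?nrm_ge0// mulVf.
  by rewrite AZ yP ipZr mulrCA.
(* If [A x + x] is not null, it has eigenvalue 1; if it is null, [x] has eigenvalue -1. *)
have [y0|yN0] := eqVneq (nrm (A x + x)) 0; last first.
  apply: (normalize (A x + x) 1) => [||h]; rewrite ?normr1//.
  by rewrite Asym !ipDr -!Asym AAx mul1r addrC.
apply: (normalize x (-1)) => [||h]; rewrite ?normrN1//.
have := ip_nrm0 h y0; rewrite ipDr => /eqP; rewrite addr_eq0 => /eqP ->.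
by rewrite rcN rc1 mulN1r.
Qed.

End top_eigenvector.

(* [t f g] stands for the kernel [f g^*], so that [ip (t f g) M] is [f^* M g]. *)
Record is_tensor (R : realType) (H HH : semiHilbert R) (t : H -> H -> HH) := IsTensor {
  tDl : forall f f' g, t (f + f') g = t f g + t f' g;
  tZl : forall a f g, t (a *: f) g = a *: t f g;
  tDr : forall f g g', t f (g + g') = t f g + t f g';
  tZr : forall a f g, t f (a *: g) = conjc a *: t f g;
  ipt : forall f g f' g', ip (t f g) (t f' g') = ip f f' * ip g' g;
  t_total : forall M, (forall f g, ip (t f g) M = 0) -> nrm M = 0
}.

(** * Kernels as sesquilinear forms, eigenpairs, deflation *)

Section spectral.
Context {R : realType} {H HH : semiHilbert R} (t : H -> H -> HH).
Hypothesis tP : is_tensor t.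
Implicit Types (M N K : HH) (f g : H) (P I : pred nat) (l : nat -> R) (e : nat -> H).

Definition sform M f g := ip (t f g) M.
Definition hermitian_kernel M := forall f g, sform M f g = conjc (sform M g f).
Definition opbound M (c : R) :=
  forall f g, modulus (sform M f g) <= c * (nrm f * nrm g).

Lemma sformDl M f f' g : sform M (f + f') g = sform M f g + sform M f' g.
Proof. by rewrite /sform (tDl tP) ipDl. Qed.

Lemma sformZl M a f g : sform M (a *: f) g = conjc a * sform M f g.
Proof. by rewrite /sform (tZl tP) ipZl. Qed.

Lemma sformDr M f g g' : sform M f (g + g') = sform M f g + sform M f g'.
Proof. by rewrite /sform (tDr tP) ipDl. Qed.

Lemma sformZr M a f g : sform M f (a *: g) = a * sform M f g.
Proof. by rewrite /sform (tZr tP) ipZl conjcK. Qed.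

Lemma sform0r M f : sform M f 0 = 0.
Proof. by rewrite -(scale0r 0) sformZr mul0r. Qed.

Lemma sform0l M f : sform M 0 f = 0.
Proof. by rewrite -(scale0r 0) sformZl conjc0 mul0r. Qed.

Lemma sform_sumr M f (I : Type) (r : seq I) (P : pred I) (F : I -> H) :
  sform M f (\sum_(i <- r | P i) F i) = \sum_(i <- r | P i) sform M f (F i).
Proof.
elim/big_rec2: _ => [|i y1 y2 Pi <-]; first exact: sform0r.
by rewrite sformDr.
Qed.

Lemma sform_suml M f (I : Type) (r : seq I) (P : pred I) (F : I -> H) :
  sform M (\sum_(i <- r | P i) F i) f = \sum_(i <- r | P i) sform M (F i) f.
Proof.
elim/big_rec2: _ => [|i y1 y2 Pi <-]; first exact: sform0l.
by rewrite sformDl.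
Qed.

Lemma sformD M N f g : sform (M + N) f g = sform M f g + sform N f g.
Proof. exact: ipDr. Qed.

Lemma sformB M N f g : sform (M - N) f g = sform M f g - sform N f g.
Proof. exact: ipBr. Qed.

Lemma sformZ a M f g : sform (a *: M) f g = a * sform M f g.
Proof. exact: ipZr. Qed.

Lemma sform_tensor (e f g : H) : sform (t e e) f g = ip f e * ip e g.
Proof. exact: (ipt tP). Qed.

Lemma nrm_tensor f g : nrm (t f g) = nrm f * nrm g.
Proof. by rewrite /nrm /sqn (ipt tP) !ip_sqn -rcM/= sqrtrM// ip_ge0. Qed.

Lemma opbound_nrm M : opbound M (nrm M).
Proof. by move=> f g; rewrite (le_trans (modulus_ip _ _))// nrm_tensor mulrC. Qed.

Lemma opbound_le M (c c' : R) : c <= c' -> opbound M c -> opbound M c'.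
Proof.
by move=> cc' h f g; rewrite (le_trans (h f g))// ler_wpM2r// mulr_ge0 ?nrm_ge0.
Qed.

Lemma opboundD M N (c c' : R) : opbound M c -> opbound N c' -> opbound (M + N) (c + c').
Proof.
by move=> h h' f g; rewrite sformD (le_trans (modulusD _ _))// mulrDl lerD.
Qed.

Lemma opboundN M (c : R) : opbound M c -> opbound (- M) c.
Proof. by move=> h f g; rewrite /sform ipNr modulusN; exact: h. Qed.

Lemma sform_nrm0 M f g : nrm g = 0 -> sform M f g = 0.
Proof.
move=> g0; apply: modulus_eq0; apply/eqP; rewrite eq_le modulus_ge0 andbT.
by rewrite (le_trans (opbound_nrm _ _ _))// g0 !mulr0.
Qed.

Lemma hermitianB M N : hermitian_kernel M -> hermitian_kernel N -> hermitian_kernel (M - N).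
Proof. by move=> hM hN f g; rewrite !sformB rmorphB/= -hM -hN. Qed.

Lemma hermitian_tensor (l : R) (e : H) : hermitian_kernel (rc l *: t e e).
Proof.
move=> f g; rewrite !sformZ !sform_tensor !rmorphM/= -[Complex l (- 0)]/(conjc (rc l)) rcJ.
by rewrite -!ipC [ip e g * _]mulrC.
Qed.

(** Riesz for each [g] separately, followed by choice. The function [A] obtained this way is linear
    only up to vectors of norm 0. *)
Lemma sform_operator M : exists A : H -> H, forall f g, ip f (A g) = sform M f g.
Proof.
suff h g : exists Ag, forall f, ip f Ag = sform M f g.
  by have [A AP] := choice h; exists A => f g; exact: AP.
apply: (@Riesz _ _ (fun f => sform M f g) (nrm M * nrm g)).
- by move=> f f'; exact: sformDl.
- by move=> a f; exact: sformZl.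
- by move=> f; rewrite (le_trans (opbound_nrm _ _ _))// [nrm f * _]mulrC mulrA.
Qed.

(** Test [M] against [Z], the sum of the tensors of [A (e k)] and [e k]. Both [ip Z M] and [sqn Z]
    equal the sum [T] to be bounded, so Cauchy-Schwarz reads [T ^+ 2 <= T * sqn M]. *)
Lemma HilbertSchmidt_bound M (A : H -> H) n (e : nat -> H) :
  (forall f g, ip f (A g) = sform M f g) -> ON (fun k => (k < n)%N) e ->
  \sum_(k < n) sqn (A (e k)) <= sqn M.
Proof.
move=> AP eON; set T := \sum_(k < n) _.
pose Z := \sum_(k < n) t (A (e k)) (e k).
have ZM : ip Z M = rc T.
  rewrite ip_suml rc_sum; apply: eq_bigr => k _.
  by rewrite -[LHS]/(sform M _ _) -AP ip_sqn.
have ZZ : sqn Z = T.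
  rewrite /sqn -[RHS]/(complex.Re (rc T)); congr (complex.Re _).
  rewrite ip_suml rc_sum; apply: eq_bigr => k _.
  rewrite ip_sumr (bigD1 k)//= big1 => [|l lk].
    by rewrite (ipt tP) eON// eqxx mulr1 addr0 ip_sqn.
  by rewrite (ipt tP) eON// (negPf (_ : (l : nat) != k)) ?mulr0//.
have T0 : 0 <= T by rewrite -ZZ sqn_ge0.
have := modulus_ip_sqr Z M; rewrite ZM modulus_rc real_normK ?num_real// ZZ.
have [->|TN0] := eqVneq T 0; first by rewrite sqn_ge0.
by rewrite expr2 ler_pM2l// lt_neqAle eq_sym TN0.
Qed.

Lemma nrm_normalize f : nrm f != 0 -> nrm (rc ((nrm f)^-1) *: f) = 1.
Proof. by move=> f0; rewrite nrmZ modulus_rc ger0_norm ?invr_ge0 ?nrm_ge0// mulVf. Qed.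

(** Let [s] be the operator norm. After division by [s] the operator is a symmetric contraction of
    norm 1 with the Hilbert-Schmidt bound, so it has an eigenvalue 1 or -1 and [M] has [s] or [- s].
    The eigenvector is promised only for a nonzero value, since a null kernel on a null space has no
    unit vector. *)
Lemma top_eigenpair M : hermitian_kernel M -> exists (p : H * R),
  opbound M `|p.2| /\ (p.2 != 0 -> nrm p.1 = 1 /\
    forall f, sform M f p.1 = rc p.2 * ip f p.1).
Proof.
move=> hM; have [A AP] := sform_operator M.
have Asym f g : ip f (A g) = ip (A f) g by rewrite AP hM ipC AP.
have sqnAZ c f : sqn (A (c *: f)) = modulus c ^+ 2 * sqn (A f).
  have AZ g : ip g (A (c *: f)) = c * ip g (A f) by rewrite Asym ipZr Asym.
  by rewrite /sqn AZ ipC AZ rmorphM/= mulrA mulcJ ip_sqn rcJ -rcM.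
have Ab f : sqn (A f) <= sqn M * sqn f.
  have : modulus (ip (A f) (A f)) <= nrm M * (nrm (A f) * nrm f).
    by rewrite AP; exact: opbound_nrm.
  rewrite ip_sqn modulus_rc ger0_norm ?sqn_ge0// -!sqr_nrm.
  have [->|Af0] := eqVneq (nrm (A f)) 0.
    by move=> _; rewrite expr0n/= mulr_ge0 ?sqr_ge0.
  rewrite {1}expr2 mulrCA ler_pM2l ?lt_neqAle 1?eq_sym ?Af0 ?nrm_ge0//.
  by move=> h; rewrite -exprMn lerXn2r ?nnegrE ?mulr_ge0 ?nrm_ge0.
have op_of (s : R) : 0 <= s -> (forall f, sqn (A f) <= s ^+ 2 * sqn f) -> opbound M s.
  move=> s0 h f g; rewrite -AP (le_trans (modulus_ip _ _))// mulrCA.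
  rewrite ler_wpM2l ?nrm_ge0// -(@ler_pXn2r _ 2)// ?nnegrE ?mulr_ge0 ?nrm_ge0//.
  by rewrite exprMn !sqr_nrm.
(* Without unit vectors every norm is 0, and the pair [(0, 0)] serves. *)
have [[f1 f1P]|noune] := pselect (exists f, sqn f = 1); last first.
  exists (0, 0); split=> [|/=]; last by rewrite eqxx.
  rewrite normr0; apply: op_of => // f; rewrite expr0n/= mul0r.
  rewrite (le_trans (Ab f))//; have [f0|/nrm_normalize h] := eqVneq (nrm f) 0.
    by rewrite -(sqr_nrm f) f0 expr0n/= mulr0.
  by exfalso; apply: noune; exists (rc ((nrm f)^-1) *: f); rewrite -sqr_nrm h expr1n.
pose S := [set x : R | exists2 f, sqn f = 1 & x = sqn (A f)].
have supS : has_sup S.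
  split; first by exists (sqn (A f1)), f1.
  by exists (sqn M) => _ [f ff ->]; rewrite (le_trans (Ab f))// ff mulr1.
pose s2 := sup S; pose s := Num.sqrt s2.
have s2P f : sqn f = 1 -> sqn (A f) <= s2.
  by move=> ff; apply: sup_ubound; [exact: supS.2|exists f].
have s20 : 0 <= s2 by rewrite (le_trans _ (s2P _ f1P))// sqn_ge0.
have sE : s ^+ 2 = s2 by rewrite sqr_sqrtr.
have s0 : 0 <= s by exact: sqrtr_ge0.
have As f : sqn (A f) <= s ^+ 2 * sqn f.
  rewrite sE; have [f0|fN0] := eqVneq (nrm f) 0.
    by rewrite (le_trans (Ab f))// -(sqr_nrm f) f0 expr0n/= !mulr0.
  have := s2P (rc ((nrm f)^-1) *: f); rewrite -sqr_nrm nrm_normalize// expr1n.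
  move=> /(_ erefl); rewrite sqnAZ modulus_rc ger0_norm ?invr_ge0 ?nrm_ge0//.
  rewrite exprVn sqr_nrm mulrC ler_pdivrMr// -sqr_nrm exprn_gt0//.
  by rewrite lt_neqAle eq_sym fN0 nrm_ge0.
have [sz|sN0] := eqVneq s 0.
  exists (0, 0); split=> [|/=]; last by rewrite eqxx.
  by rewrite normr0 -sz; exact: op_of.
have sgt0 : 0 < s by rewrite lt_neqAle eq_sym sN0.
pose A' f := rc (s^-1) *: A f.
have sqnA' f : sqn (A' f) = sqn (A f) / s ^+ 2.
  by rewrite sqnZ modulus_rc ger0_norm ?invr_ge0// exprVn mulrC.
have [||||e [l [l1 e1 eP]]] := @top_eigenvector _ _ A'.
- by move=> f g; rewrite ipZr ipZl rcJ Asym.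
- by move=> f; rewrite sqnA' ler_pdivrMr ?exprn_gt0// mulrC.
- exists (sqn M / s ^+ 2) => n e eON.
  rewrite (eq_bigr (fun k : 'I_n => sqn (A (e k)) / s ^+ 2)); last by move=> k _; exact: sqnA'.
  by rewrite -mulr_suml ler_pM2r ?invr_gt0 ?exprn_gt0//; exact: HilbertSchmidt_bound AP eON.
- move=> d d0; have sd : 0 < s2 * d by rewrite mulr_gt0// -sE exprn_gt0.
  have [_ [f ff ->] lt] := sup_adherent sd supS.
  exists f; split=> //; rewrite sqnA' ltr_pdivlMr ?exprn_gt0// sE.
  by rewrite mulrBl mul1r [d * _]mulrC.
exists (e, s * l); rewrite /= normrM l1 mulr1 ger0_norm//; split; first exact: op_of.
move=> _; split=> // f; have := eP f; rewrite ipZr AP rcM -mulrA => <-.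
by rewrite mulrA -rcM mulfV// rc1 mul1r.
Qed.

Definition spec_sum (P : pred nat) (l : nat -> R) (e : nat -> H) n :=
  \sum_(k < n | P k) rc (l k) *: t (e k) (e k).

Lemma sform_spec_sum P l e n f g :
  sform (spec_sum P l e n) f g = \sum_(k < n | P k) rc (l k) * (ip f (e k) * ip (e k) g).
Proof.
rewrite /sform ip_sumr; apply: eq_bigr => k _.
by rewrite ipZr -[ip _ _]/(sform _ f g) sform_tensor.
Qed.

Lemma ON_tensor P e : ON P e -> ON P (fun k => t (e k) (e k)).
Proof.
move=> eON k l Pk Pl; rewrite (ipt tP) !eON// eq_sym.
by case: eqP => _; rewrite ?mulr1 ?mulr0.
Qed.

Lemma sqn_spec_sum P l e n : ON P e -> sqn (spec_sum P l e n) = \sum_(k < n | P k) l k ^+ 2.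
Proof.
move=> /ON_tensor eON; rewrite (sqn_ON_sum (fun k => rc (l k)) n eON).
by apply: eq_bigr => k _; rewrite modulus_rc real_normK ?num_real.
Qed.

Lemma sform_spec_sum_eigen P l e n k f : ON P e -> P k -> (k < n)%N ->
  sform (spec_sum P l e n) f (e k) = rc (l k) * ip f (e k).
Proof.
move=> eON Pk kn; rewrite sform_spec_sum (bigD1 (Ordinal kn))//= big1 ?addr0.
  by rewrite eON// eqxx mulr1.
move=> j /andP[Pj jk]; rewrite eON// (negPf (_ : (j : nat) != k)) ?mulr0//.
Qed.

(** The tensors of the [e k] with themselves are orthonormal, so the squared distance of two partial
    sums is the increment of a bounded nondecreasing real sequence. *)
Lemma spec_sum_cvg P l e (C : R) : ON P e ->
  (forall n, \sum_(k < n | P k) l k ^+ 2 <= C) -> exists N, hcvg (spec_sum P l e) N.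
Proof.
move=> eON lC; pose q n := \sum_(k < n | P k) l k ^+ 2.
have qS n : q n <= q n.+1.
  rewrite /q [leRHS]big_mkcond big_ord_recr/= -big_mkcond/= lerDl.
  by case: ifP => // _; exact: sqr_ge0.
have qnd : nondecreasing_seq q by apply/nondecreasing_seqP.
apply: (@complete_increments _ _ _ q).
  by apply: nondecreasing_is_cvgn => //; exists C => _ [n _ <-]; exact: lC.
move=> m n mn; rewrite ger0_norm ?subr_ge0 ?qnd// sqnB !sqn_spec_sum//.
have -> : ip (spec_sum P l e n) (spec_sum P l e m) = rc (q m).
  rewrite ipC ip_suml rmorph_sum/= rc_sum; apply: eq_bigr => k Pk.
  rewrite -ipC ipZr -[X in _ * X]conjcK -ipC -[ip _ _]/(sform _ _ _).
  rewrite sform_spec_sum_eigen// ?(leq_trans (ltn_ord k))// eON// eqxx mulr1.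
  by rewrite rcJ -rcM expr2.
rewrite -[complex.Re _]/(q m) -/(q m) -/(q n).
by rewrite le_eqVlt; apply/orP; left; apply/eqP; ring.
Qed.

Definition spec_dec M (I : pred nat) (l : nat -> R) (e : nat -> H) :=
  ON I e /\ hcvg (spec_sum I l e) M.

(* Deflation: subtract the top eigenpair and iterate. *)
Theorem spectral_theorem M : hermitian_kernel M -> exists I l e, spec_dec M I l e.
Proof.
move=> hM.
(* The hypothesis on [M'] is put inside the existential, with [(0, 0)] as default, so that choice
   yields a function on all kernels and the recursion [st] needs no proofs. *)
have topP M' : exists p : H * R, hermitian_kernel M' -> opbound M' `|p.2| /\
    (p.2 != 0 -> nrm p.1 = 1 /\ forall f, sform M' f p.1 = rc p.2 * ip f p.1).
  have [h|h] := pselect (hermitian_kernel M'); last by exists (0, 0).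
  by have [p pP] := top_eigenpair h; exists p.
have {topP}[top topP] := choice topP.
pose fix st n := if n is n'.+1 then
  st n' - rc (top (st n')).2 *: t (top (st n')).1 (top (st n')).1 else M.
pose e n := (top (st n)).1; pose l n := (top (st n)).2.
(* Zero values are dropped because [top] promises no unit vector for them; they do not change the
   sums. *)
pose I k := l k != 0.
have st_herm n : hermitian_kernel (st n).
  elim: n => //= n ih; apply: hermitianB => //; exact: hermitian_tensor.
have st_op n : opbound (st n) `|l n| by have [] := topP _ (st_herm n).
have e1 n : I n -> nrm (e n) = 1 by move=> In; have [_ /(_ In)[]] := topP _ (st_herm n).
have eig n f : I n -> sform (st n) f (e n) = rc (l n) * ip f (e n).
  by move=> In; have [_ /(_ In)[]] := topP _ (st_herm n).
have ip_e0 j n : I n -> sform (st n) (e n) (e j) = 0 -> ip (e j) (e n) = 0.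
  move=> In h; have := eig n (e j) In; rewrite st_herm h conjc0 => /esym/eqP.
  by rewrite mulf_eq0 => /orP[/eqP[ln0]|/eqP//]; move: In; rewrite /I ln0 eqxx.
have ee n : I n -> ip (e n) (e n) = 1.
  by move=> In; rewrite ip_sqn -sqr_nrm e1// expr1n.
(* [st n] annihilates every earlier eigenvector: subtracting the [j]-th pair kills [e j], and the
   later pairs are orthogonal to it. Applied to [e n], this gives orthonormality. *)
have vanish n j f : (j < n)%N -> I j -> sform (st n) f (e j) = 0.
  elim: n f => // n ih f jn Ij; rewrite /= sformB sformZ sform_tensor.
  move: jn; rewrite ltnS leq_eqVlt => /predU1P[jE|jn].
    by rewrite jE in Ij *; rewrite -/(e n) -/(l n) eig// ee// mulr1 subrr.
  rewrite ih// sub0r -/(e n) -/(l n); have [ln0|ln0] := eqVneq (l n) 0.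
    by rewrite ln0 rc0 mul0r oppr0.
  by rewrite [ip (e n) _]ipC ip_e0 ?ih// conjc0 !mulr0 oppr0.
have eON : ON I e.
  suff lt k n : (k < n)%N -> I k -> I n -> ip (e k) (e n) = 0.
    move=> k n Ik In; case: (ltngtP k n) => [kn|nk|->]; last exact: ee.
      exact: lt.
    by rewrite ipC lt// conjc0.
  by move=> kn Ik In; apply: ip_e0 => //; exact: vanish.
have stE n : st n = M - spec_sum I l e n.
  rewrite /spec_sum; elim: n => [|n ih]; first by rewrite big_ord0 subr0.
  rewrite /= ih [in RHS]big_mkcond big_ord_recr/= -big_mkcond/= opprD addrA.
  congr (_ - _); rewrite -ih -/(e n) -/(l n) /I.
  by have [->|//] := eqVneq (l n) 0; rewrite rc0 scale0r.
(* The eigenvalues are the coefficients of [M] along orthonormal tensors, so Bessel in the space of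
   kernels makes them square summable. *)
have MT k : I k -> ip (t (e k) (e k)) M = rc (l k).
  move=> Ik; rewrite -[LHS]/(sform M (e k) (e k)).
  have -> : sform M (e k) (e k) = sform (st k) (e k) (e k) + sform (spec_sum I l e k) (e k) (e k).
    by rewrite stE sformB subrK.
  rewrite eig// ee// mulr1 sform_spec_sum big1 ?addr0// => j Ij.
  by rewrite eON// gtn_eqF ?ltn_ord// mul0r mulr0.
have lC n : \sum_(k < n | I k) l k ^+ 2 <= sqn M.
  apply: le_trans (Bessel n M (ON_tensor eON)).
  by apply: ler_sum => k Ik; rewrite MT// modulus_rc real_normK ?num_real.
exists I, l, e; split=> //.
have [N NP] := spec_sum_cvg eON lC.
suff : nrm (N - M) = 0 by move=> /hcvg_congr; apply.
(* [l n ^+ 2] is an increment of the convergent partial sums [q]. *)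
have l0 : null_seq (fun n => `|l n|).
  suff : null_seq (fun n => Num.sqrt (l n ^+ 2)).
    by congr null_seq; apply/funext => n; rewrite sqrtr_sqr.
  apply: null_seq_sqrt => [n|]; first exact: sqr_ge0.
  pose q n := \sum_(k < n | I k) l k ^+ 2.
  have qS n : q n.+1 = q n + l n ^+ 2.
    rewrite /q [in LHS]big_mkcond big_ord_recr/= -big_mkcond/= /I.
    by have [->|//] := eqVneq (l n) 0; rewrite expr0n.
  have qnd : nondecreasing_seq q.
    by apply/nondecreasing_seqP => n; rewrite qS lerDl sqr_ge0.
  have qc : cvgn q by apply: nondecreasing_is_cvgn => //; exists (sqn M) => _ [n _ <-]; exact: lC.
  have -> : (fun n => l n ^+ 2) = (fun n => q n.+1 - q n).
    by apply/funext => n; rewrite qS addrC addKr.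
  rewrite /null_seq -(subrr (limn q)); apply: cvgB => //.
  by rewrite (cvg_shiftS q).
(* [N - M] is [N] minus a partial sum, minus the remainder [st n], whose operator norm is at most
   [|l n|]. Both tend to 0 against every tensor. *)
apply: (t_total tP) => f g; apply: modulus_eq0; apply/eqP.
rewrite eq_le modulus_ge0 andbT.
apply: null_seq_ge (null_seqZr (nrm f * nrm g) (null_seqD NP l0)) => n.
have -> : N - M = - (spec_sum I l e n - N) - st n.
  by rewrite stE !opprB addrA subrK.
rewrite mulrDl ipBr (le_trans (modulusD _ _))// modulusN lerD//; last exact: st_op.
by have := opboundN (opbound_nrm (spec_sum I l e n - N)); exact.
Qed.

End spectral.

(** * Truncations *)

(** An interval with no point of [s] inside is kept; a new point falling inside cuts it, and the
    left piece is retained. [c] is its midpoint, and [d] a quarter of its length rather than half,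
    so that [a < c - d] is strict. *)
Lemma avoid_finite (R : realType) (s : seq R) (a b : R) : a < b ->
  exists c d, [/\ a < c - d, c < b, 0 < d & forall x, x \in s -> d <= `|x - c|].
Proof.
move=> ab.
suff [a' [b' [aa' ab' b'b sP]]] : exists a' b', [/\ a <= a', a' < b', b' <= b &
    forall x, x \in s -> x <= a' \/ b' <= x].
  exists ((a' + b') / 2), ((b' - a') / 4); split; [lra|lra|lra|].
  by move=> x /sP[xa'|xb']; rewrite ler_normr; apply/orP; [right|left]; lra.
elim: s => [|y s [a' [b' [aa' ab' b'b sP]]]]; first by exists a, b.
have [ya|ay] := leP y a'.
  by exists a', b'; split=> // x; rewrite inE => /predU1P[->|/sP//]; left.
have [yb|by'] := leP b' y.
  by exists a', b'; split=> // x; rewrite inE => /predU1P[->|/sP//]; right.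
exists a', y; split=> //; first by rewrite (le_trans (ltW by')).
move=> x; rewrite inE => /predU1P[->|/sP[|bx]]; [by right|by left|right].
by rewrite (le_trans (ltW by')).
Qed.

Section truncations.
Context {R : realType} {H HH : semiHilbert R} (t : H -> H -> HH).
Hypothesis tP : is_tensor t.
Implicit Types (M N K : HH) (f g : H) (P I : pred nat) (l : nat -> R) (e : nat -> H).

Definition is_trunc M (a : R) N := exists I l e, spec_dec t M I l e /\
  hcvg (spec_sum t (fun k => I k && (a < `|l k|)) l e) N.

Lemma spec_dec_eigen M I l e k f : spec_dec t M I l e -> I k ->
  sform t M f (e k) = rc (l k) * ip f (e k).
Proof.
move=> [eON eM] Ik; apply: (hcvg_ip_cst_near (N := k.+1) eM) => n kn.
exact: sform_spec_sum_eigen.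
Qed.

Lemma spec_dec_sum_le M I l e P n : spec_dec t M I l e -> (forall k, P k -> I k) ->
  \sum_(k < n | P k) l k ^+ 2 <= sqn M.
Proof.
move=> de PI; have [eON _] := de.
have PON : ON P (fun k => t (e k) (e k)).
  by apply: ON_tensor => // k j /PI Ik /PI Ij; exact: eON.
apply: le_trans (Bessel n M PON).
apply: ler_sum => k /PI Ik; rewrite -[ip _ _]/(sform t M _ _).
rewrite (spec_dec_eigen _ de)// eON// eqxx mulr1 modulus_rc.
by rewrite real_normK ?num_real.
Qed.

Lemma is_trunc_ex M (a : R) : hermitian_kernel t M -> exists N, is_trunc M a N.
Proof.
move=> /(spectral_theorem tP)[I [l [e de]]].
have [|n|N NP] := @spec_sum_cvg _ _ _ t tP (fun k => I k && (a < `|l k|)) l e (sqn M).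
- by have [eON _] := de; move=> k j /andP[Ik _] /andP[Ij _]; exact: eON.
- by apply: (spec_dec_sum_le (P := fun k => I k && (a < `|l k|)) n de) => k /andP[].
by exists N, I, l, e.
Qed.

(** Otherwise arbitrarily many indices would each contribute at least [a ^+ 2] to a sum bounded by
    [sqn M]. *)
Lemma finitely_many_large M I l e (a : R) : spec_dec t M I l e -> 0 < a ->
  exists n, forall k, (n <= k)%N -> I k -> `|l k| <= a.
Proof.
move=> de a0; apply/not_existsP => hno.
have nx n : exists k, [/\ (n <= k)%N, I k & a < `|l k|].
  have := hno n; move/existsNP => [k /not_implyP[nk /not_implyP[Ik /negP]]].
  by rewrite -ltNge => lt; exists k.
suff h m : exists n, a ^+ 2 *+ m <= \sum_(k < n | I k) l k ^+ 2.
  have [m mP] : exists m, sqn M < a ^+ 2 *+ m.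
    have a20 : 0 < a ^+ 2 by rewrite exprn_gt0.
    exists (Num.bound (sqn M / a ^+ 2)); rewrite -mulr_natl -ltr_pdivrMr//.
    by rewrite archi_boundP// divr_ge0 ?sqn_ge0 ?sqr_ge0.
  have [n nP] := h m; have := spec_dec_sum_le n de (fun k => id).
  by move/(le_trans nP)/(lt_le_trans mP); rewrite ltxx.
elim: m => [|m [n ih]].
  by exists 0%N; rewrite mulr0n sumr_ge0// => k _; exact: sqr_ge0.
have [k [nk Ik lk]] := nx n; exists k.+1.
rewrite mulrSr [leRHS]big_mkcond big_ord_recr/= Ik -big_mkcond/=.
rewrite lerD//; last first.
  by rewrite -[leRHS]real_normK ?num_real// lerXn2r ?nnegrE ?(ltW a0) ?(ltW lk).
apply: (le_trans ih); rewrite -(big_mkord (fun k => I k) (fun k => l k ^+ 2)).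
rewrite -[leRHS](big_mkord (fun k => I k) (fun k => l k ^+ 2)) (big_cat_nat _ nk)//=.
by rewrite lerDl sumr_ge0// => j _; exact: sqr_ge0.
Qed.

(* [N] collects finitely many spectral terms of [M], and what remains has operator
   norm at most [c]. *)
Record finite_part M N (c : R) n P l e : Prop := FinitePart {
  fp_on : ON P e;
  fp_lt : forall k, P k -> (k < n)%N;
  fp_eigen : forall k f, P k -> sform t M f (e k) = rc (l k) * ip f (e k);
  fp_sum : nrm (N - spec_sum t P l e n) = 0;
  fp_op : opbound t (M - N) c
}.

Lemma ip_congr (G : semiHilbert R) (f g g' : G) : nrm (g - g') = 0 -> ip f g = ip f g'.
Proof. by move=> h; apply/eqP; rewrite -subr_eq0 -ipBr ip_nrm0. Qed.

Lemma fp_form M N c n P l e f g : finite_part M N c n P l e ->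
  sform t N f g = \sum_(k < n | P k) rc (l k) * (ip f (e k) * ip (e k) g).
Proof. by case=> _ _ _ h _; rewrite -(sform_spec_sum tP); exact: ip_congr. Qed.

Lemma fp_sqn M N c n P l e : finite_part M N c n P l e ->
  sqn N = \sum_(k < n | P k) l k ^+ 2.
Proof.
case=> eON _ _ h _; rewrite -(sqn_spec_sum tP l n eON) -!sqr_nrm.
congr (_ ^+ 2); apply/eqP; rewrite eq_le; apply/andP; split.
  by have := nrmD (N - spec_sum t P l e n) (spec_sum t P l e n); rewrite subrK h add0r.
by rewrite nrmBC in h; have := nrmD (spec_sum t P l e n - N) N; rewrite subrK h add0r.
Qed.

(** The sum sends [g] to the vector with coordinates [l k <e k, g>], of norm at most [c * nrm g] by
    Bessel. *)
Lemma opbound_spec_sum P l e n (c : R) : ON P e -> (forall k, P k -> `|l k| <= c) ->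
  0 <= c -> opbound t (spec_sum t P l e n) c.
Proof.
move=> eON lc c0 f g; rewrite sform_spec_sum//.
have -> : \sum_(k < n | P k) rc (l k) * (ip f (e k) * ip (e k) g) =
    ip f (\sum_(k < n | P k) (rc (l k) * ip (e k) g) *: e k).
  by rewrite ip_sumr; apply: eq_bigr => k _; rewrite ipZr; ring.
rewrite (le_trans (modulus_ip _ _))// mulrCA ler_wpM2l ?nrm_ge0//.
rewrite -(@ler_pXn2r _ 2)// ?nnegrE ?mulr_ge0 ?nrm_ge0// exprMn !sqr_nrm.
rewrite (sqn_ON_sum (fun k => rc (l k) * ip (e k) g) n eON).
apply: le_trans (_ : c ^+ 2 * \sum_(k < n | P k) modulus (ip (e k) g) ^+ 2 <= _).
  rewrite mulr_sumr ler_sum// => k Pk; rewrite modulusM modulus_rc exprMn.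
  by rewrite ler_wpM2r ?sqr_ge0// lerXn2r ?nnegrE ?lc.
by rewrite ler_wpM2l ?sqr_ge0//; exact: Bessel.
Qed.

(** The threshold [a] selects the terms while [c] bounds the others. They are kept apart because [c]
    can be smaller than [a] when [a] lies in a spectral gap. *)
Lemma finite_part_ex M I l e (a c : R) N : spec_dec t M I l e -> 0 < a -> 0 <= c ->
  (forall k, I k -> `|l k| <= a -> `|l k| <= c) ->
  hcvg (spec_sum t (fun k => I k && (a < `|l k|)) l e) N ->
  exists n, finite_part M N c n (fun k => I k && (a < `|l k|)) l e.
Proof.
move=> de a0 c0 ac NP; have [eON eM] := de.
have [n0 n0P] := finitely_many_large de a0.
pose P k := I k && (a < `|l k|).
have Plt k : P k -> (k < n0)%N.
  by case/andP=> Ik; rewrite ltNge => /negP la; rewrite ltnNge; apply/negP => /n0P/(_ Ik).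
have sumE n : (n0 <= n)%N -> spec_sum t P l e n = spec_sum t P l e n0.
  move=> n0n; rewrite /spec_sum -(big_mkord P (fun k => rc (l k) *: t (e k) (e k))).
  rewrite (big_cat_nat _ n0n)//= [X in _ + X]big_nat_cond [X in _ + X]big1 ?addr0 ?big_mkord//.
  by move=> k /andP[/andP[n0k _] /Plt]; rewrite ltnNge n0k.
have PON : ON P e by move=> k j /andP[Ik _] /andP[Ij _]; exact: eON.
exists n0; split=> //.
- by move=> k f /andP[Ik _]; exact: spec_dec_eigen de Ik.
- apply/eqP; rewrite eq_le nrm_ge0 andbT.
  by apply: (null_seq_ge_near (N := n0) _ NP) => n n0n; rewrite -(sumE n)// nrmBC.
(* Up to two errors tending to 0, [M - N] is the partial sum over the complementary indices [Q],
   whose eigenvalues are at most [c]. *)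
- move=> f g; rewrite -subr_le0.
  apply: (null_seq_ge _ (null_seqZr (nrm f * nrm g) (null_seqD eM NP))) => n.
  pose Q k := I k && ~~ (a < `|l k|).
  have -> : M - N = - (spec_sum t I l e n - M) + (spec_sum t P l e n - N)
      + spec_sum t Q l e n.
    have -> : spec_sum t I l e n = spec_sum t Q l e n + spec_sum t P l e n.
      by rewrite addrC /spec_sum (bigID (fun k : 'I_n => a < `|l k|)).
    by rewrite opprB opprD !addrA subrK addrAC subrK.
  rewrite lerBlDr mulrDl 2!sformD.
  rewrite (le_trans (modulusD _ _))// lerD//.
    rewrite (le_trans (modulusD _ _))// lerD//.
      by apply: opboundN; exact: (opbound_nrm tP).
    exact: (opbound_nrm tP).
  apply: opbound_spec_sum => //.
    by move=> k j /andP[Ik _] /andP[Ij _]; exact: eON.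
  by move=> k /andP[Ik]; rewrite -leNgt; exact: ac.
Qed.

Lemma is_trunc_finite_part M (a : R) N : 0 < a -> is_trunc M a N ->
  exists n P l e, finite_part M N a n P l e /\ forall k, P k -> a < `|l k|.
Proof.
move=> a0 [I [l [e [de NP]]]].
have [//|n nP] := finite_part_ex de a0 (ltW a0) _ NP.
by exists n, (fun k => I k && (a < `|l k|)), l, e; split=> // k /andP[].
Qed.

(* The Davis-Kahan argument, in quantitative form. *)
Lemma residual_eigenvector M K N (c d eps m : R) n P l e v :
  finite_part K N c n P l e -> (forall f, sform t M f v = rc m * ip f v) ->
  opbound t (M - K) eps -> 0 <= eps -> c + d <= `|m| ->
  d * nrm (residual P e n v) <= eps * nrm v.
Proof.
move=> fp Mv MK eps0 cdm; have [eON elt eig _ Nop] := fp.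
set w := residual P e n v.
have vE : v = w + \sum_(k < n | P k) ip (e k) v *: e k by rewrite subrK.
have we k : P k -> ip (e k) w = 0 by move=> Pk; apply: ip_residual => //; exact: elt.
have we' k : P k -> ip w (e k) = 0 by move=> Pk; rewrite ipC we// conjc0.
have wv : ip w v = rc (sqn w).
  rewrite vE ipDr ip_sqn ip_sumr big1 ?addr0// => k Pk.
  by rewrite ipZr we'// mulr0.
(* [N] kills [w], and the components of [v] along the [e k] drop out because these are eigenvectors
   of [K] orthogonal to [w]. *)
have Kwv : sform t K w v = sform t (K - N) w w.
  rewrite sformB (fp_form _ _ fp) [X in _ - X]big1 => [|k Pk]; last first.
    by rewrite we// mulr0 mulr0.
  rewrite subr0 [X in sform _ _ _ X]vE sformDr// sform_sumr// big1 ?addr0// => k Pk.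
  by rewrite sformZr// eig// we'// !mulr0.
(* The left side is the modulus of [sform t M w v]. Splitting [M] into [M - K] and [K] gives the two
   terms, the second through [Kwv]. *)
have key : `|m| * nrm w ^+ 2 <= eps * (nrm w * nrm v) + c * (nrm w * nrm w).
  rewrite sqr_nrm -[X in _ * X]ger0_norm ?sqn_ge0// -normrM -modulus_rc rcM -wv -Mv.
  rewrite -[M](subrK K) sformD Kwv (le_trans (modulusD _ _))// lerD//.
have [->|wN0] := eqVneq (nrm w) 0; first by rewrite mulr0 mulr_ge0 ?nrm_ge0.
have w0 : 0 < nrm w by rewrite lt_neqAle eq_sym wN0 nrm_ge0.
rewrite -(ler_pM2l w0) mulrCA -expr2.
have : (c + d) * nrm w ^+ 2 <= `|m| * nrm w ^+ 2 by rewrite ler_wpM2r ?sqr_ge0.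
move/le_trans/(_ key); rewrite -expr2; move: (nrm w) (nrm v) => x y.
by move=> h; rewrite -subr_ge0; move: h; rewrite -subr_ge0; congr (_ <= _); ring.
Qed.

(** The residual estimate with [K = M] and [eps = 0]: an eigenvector of [M] with eigenvalue above
    [a] lies, up to norm 0, in the span of the [e k], where [M - N] vanishes. *)
Lemma finite_part_orth M N N' (a b : R) n P l e n' P' l' e' :
  finite_part M N a n P l e -> finite_part M N' b n' P' l' e' ->
  (forall k, P' k -> a < `|l' k|) -> ip N' (M - N) = 0.
Proof.
move=> fp fp' al; have [eON elt eig Nsum _] := fp; have [e'ON _ eig' N'sum _] := fp'.
have MNe k f : P k -> sform t (M - N) f (e k) = 0.
  move=> Pk; rewrite sformB eig//.
  have -> : sform t N f (e k) = sform t (spec_sum t P l e n) f (e k) by exact: ip_congr.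
  by rewrite sform_spec_sum_eigen ?subrr//; exact: elt.
have MNe' k f : P' k -> sform t (M - N) f (e' k) = 0.
  move=> Pk.
  have w0 : nrm (residual P e n (e' k)) = 0.
    have := @residual_eigenvector M M N a (`|l' k| - a) 0 (l' k) _ _ _ _ _ fp
      (fun f => eig' k f Pk).
    rewrite subrr [a + _]addrC subrK mul0r => /(_ _ (lexx 0) (lexx _)) h.
    apply/eqP; rewrite eq_le nrm_ge0 andbT -(@ler_pM2l _ (`|l' k| - a)) ?mulr0; last first.
      by rewrite subr_gt0 al.
    by apply: h => f' g; rewrite /sform ip0r ComplexField.Normc.normc0 mul0r.
  have -> : e' k = residual P e n (e' k) + \sum_(j < n | P j) ip (e j) (e' k) *: e j.
    by rewrite subrK.
  rewrite sformDr// sform_nrm0// add0r sform_sumr// big1// => j Pj.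
  by rewrite sformZr// MNe// mulr0.
rewrite ipC (ip_congr _ N'sum) -ipC ip_suml big1// => k Pk.
by rewrite ipZl -[ip _ _]/(sform _ _ _ _) MNe' ?mulr0.
Qed.

Lemma is_trunc_orth M N N' (a b : R) : 0 < a -> a <= b ->
  is_trunc M a N -> is_trunc M b N' -> ip N' (M - N) = 0.
Proof.
move=> a0 ab /(is_trunc_finite_part a0)[n [P [l [e [fp _]]]]].
move=> /(is_trunc_finite_part (lt_le_trans a0 ab))[n' [P' [l' [e' [fp' bl]]]]].
apply: finite_part_orth fp fp' _ => k /bl; exact: le_lt_trans.
Qed.

(** Both [M - N] and [M - N'] are orthogonal to [N'], so [ip N' N = ip N' M = sqn N']. *)
Lemma sqn_is_truncB M N N' (a b : R) : 0 < a -> a <= b ->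
  is_trunc M a N -> is_trunc M b N' -> sqn (N - N') = sqn N - sqn N'.
Proof.
move=> a0 ab tN tN'.
have := is_trunc_orth a0 ab tN tN'.
have := is_trunc_orth (lt_le_trans a0 ab) (lexx b) tN' tN'.
rewrite !ipBr => /eqP; rewrite subr_eq0 => /eqP -> /eqP; rewrite subr_eq0 => /eqP h.
by rewrite sqnB Re_ipC -h ip_sqn/=; ring.
Qed.

Lemma sqn_is_trunc_le M N (a : R) : 0 < a -> is_trunc M a N -> sqn N <= sqn M.
Proof.
move=> a0 tN; have h := is_trunc_orth a0 (lexx a) tN tN.
by rewrite -[M in leRHS](subrK N) addrC sqnD h/= mulr0 addr0 lerDl sqn_ge0.
Qed.

Lemma is_trunc_opbound M N (a : R) : 0 < a -> is_trunc M a N -> opbound t (M - N) a.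
Proof. by move=> a0 /(is_trunc_finite_part a0)[n [P [l [e [[]]]]]]. Qed.

(** With the overlaps [p i j] of the two families, [sqn (N - N')] equals the sum of the
    [p i j * (l i - l' j) ^+ 2] plus the squared eigenvalues weighted by the squared residuals of
    each family against the other. The residuals are at most [eps / d]. For fixed [i] the first sum
    is at most [eps ^+ 2], and there are at most [sqn N / a ^+ 2] indices [i]. *)
Lemma sqn_finite_partB M K N N' (c c' a d eps : R) n P l e n' P' l' e' :
  hermitian_kernel t K ->
  finite_part M N c n P l e -> finite_part K N' c' n' P' l' e' ->
  (forall k, P k -> c' + d <= `|l k|) -> (forall k, P' k -> c + d <= `|l' k|) ->
  (forall k, P k -> a <= `|l k|) -> 0 < a -> 0 < d -> 0 <= eps ->
  opbound t (M - K) eps ->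
  sqn (N - N') <= eps ^+ 2 * (sqn N / a ^+ 2 + sqn N / d ^+ 2 + sqn N' / d ^+ 2).
Proof.
move=> hK fp fp' ld l'd al a0 d0 eps0 MK.
have [eON elt eig Nsum _] := fp; have [e'ON e'lt eig' N'sum _] := fp'.
pose p i j := modulus (ip (e' j) (e i)) ^+ 2.
have e1 k : P k -> nrm (e k) = 1 by move=> Pk; rewrite /nrm /sqn eON// eqxx sqrtr1.
have e1' k : P' k -> nrm (e' k) = 1 by move=> Pk; rewrite /nrm /sqn e'ON// eqxx sqrtr1.
have NN' : ip N N' = rc (\sum_(i < n | P i) \sum_(j < n' | P' j) l i * l' j * p i j).
  rewrite (ip_congr _ N'sum) ipC (ip_congr _ Nsum) -ipC ip_suml rc_sum.
  apply: eq_bigr => i Pi; rewrite ip_sumr rc_sum; apply: eq_bigr => j Pj.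
  rewrite ipZl ipZr rcJ -[ip (t _ _) _]/(sform _ _ _ _) sform_tensor//.
  by rewrite (ipC (e i)) mulJc !rcM; ring.
have res i : P i -> sqn (residual P' e' n' (e i)) <= eps ^+ 2 / d ^+ 2.
  move=> Pi; have := residual_eigenvector fp' (fun f => eig i f Pi) MK eps0 (ld i Pi).
  rewrite e1// mulr1 => h; rewrite ler_pdivlMr ?exprn_gt0// -sqr_nrm -exprMn mulrC.
  by rewrite lerXn2r ?nnegrE ?mulr_ge0 ?nrm_ge0 ?(ltW d0).
have res' j : P' j -> sqn (residual P e n (e' j)) <= eps ^+ 2 / d ^+ 2.
  move=> Pj; have KM : opbound t (K - M) eps by rewrite -opprB; exact: opboundN.
  have := residual_eigenvector fp (fun f => eig' j f Pj) KM eps0 (l'd j Pj).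
  rewrite e1'// mulr1 => h; rewrite ler_pdivlMr ?exprn_gt0// -sqr_nrm -exprMn mulrC.
  by rewrite lerXn2r ?nnegrE ?mulr_ge0 ?nrm_ge0 ?(ltW d0).
(* [(l i - l' j) <e' j, e i>] is the coefficient of [(M - K) (e i)] along [e' j]. The sum is thus
   the squared norm of a projection [z] of [(M - K) (e i)], bounded by testing [M - K] against
   [z]. *)
have diag i : P i -> \sum_(j < n' | P' j) p i j * (l i - l' j) ^+ 2 <= eps ^+ 2.
  move=> Pi; pose z := \sum_(j < n' | P' j) sform t (M - K) (e' j) (e i) *: e' j.
  have -> : \sum_(j < n' | P' j) p i j * (l i - l' j) ^+ 2 = sqn z.
    rewrite (sqn_ON_sum (fun j => sform t (M - K) (e' j) (e i)) n' e'ON).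
    apply: eq_bigr => j Pj; rewrite sformB eig// hK eig'// rmorphM/=.
    rewrite -ipC -[Complex (l' j) _]/(conjc (rc _)) rcJ -mulrBl -rcB modulusM exprMn.
    by rewrite modulus_rc real_normK ?num_real// mulrC.
  have : modulus (sform t (M - K) z (e i)) <= eps * nrm z.
    by have := MK z (e i); rewrite e1// mulr1.
  have -> : sform t (M - K) z (e i) = rc (sqn z).
    rewrite (sqn_ON_sum (fun j => sform t (M - K) (e' j) (e i)) n' e'ON).
    rewrite sform_suml// rc_sum; apply: eq_bigr => j Pj.
    by rewrite sformZl// mulJc.
  rewrite modulus_rc ger0_norm ?sqn_ge0// -sqr_nrm.
  have [->|zN0] := eqVneq (nrm z) 0; first by rewrite expr0n/= sqr_ge0.
  have z0 : 0 < nrm z by rewrite lt_neqAle eq_sym zN0 nrm_ge0.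
  by rewrite {1}expr2 ler_pM2r// => h; rewrite lerXn2r ?nnegrE ?nrm_ge0.
have resE i : P i -> sqn (residual P' e' n' (e i)) = 1 - \sum_(j < n' | P' j) p i j.
  by move=> Pi; rewrite sqn_residual// -sqr_nrm e1// expr1n.
have resE' j : P' j -> sqn (residual P e n (e' j)) = 1 - \sum_(i < n | P i) p i j.
  move=> Pj; rewrite sqn_residual// -sqr_nrm e1'// expr1n; congr (_ - _).
  by apply: eq_bigr => i _; rewrite ipC modulusJ.
have -> : sqn (N - N') = \sum_(i < n | P i) \sum_(j < n' | P' j) p i j * (l i - l' j) ^+ 2
   + \sum_(i < n | P i) l i ^+ 2 * sqn (residual P' e' n' (e i))
   + \sum_(j < n' | P' j) l' j ^+ 2 * sqn (residual P e n (e' j)).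
  rewrite sqnB NN' (fp_sqn fp) (fp_sqn fp') /=.
  have -> : \sum_(i < n | P i) l i ^+ 2 * sqn (residual P' e' n' (e i)) =
      \sum_(i < n | P i) l i ^+ 2 - \sum_(i < n | P i) \sum_(j < n' | P' j) l i ^+ 2 * p i j.
    rewrite -sumrB; apply: eq_bigr => i Pi.
    by rewrite resE// mulrBr mulr1 mulr_sumr.
  have -> : \sum_(j < n' | P' j) l' j ^+ 2 * sqn (residual P e n (e' j)) =
      \sum_(j < n' | P' j) l' j ^+ 2 - \sum_(i < n | P i) \sum_(j < n' | P' j) l' j ^+ 2 * p i j.
    rewrite exchange_big -sumrB; apply: eq_bigr => j Pj.
    by rewrite resE'// mulrBr mulr1 mulr_sumr.
  have -> : \sum_(i < n | P i) \sum_(j < n' | P' j) p i j * (l i - l' j) ^+ 2 =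
      \sum_(i < n | P i) \sum_(j < n' | P' j) l i ^+ 2 * p i j +
      \sum_(i < n | P i) \sum_(j < n' | P' j) l' j ^+ 2 * p i j -
      2 * \sum_(i < n | P i) \sum_(j < n' | P' j) l i * l' j * p i j.
    rewrite mulr_sumr -big_split -sumrB; apply: eq_bigr => i Pi /=.
    rewrite mulr_sumr -big_split -sumrB; apply: eq_bigr => j Pj /=.
    ring.
  ring.
rewrite !mulrDr; apply: lerD; first apply: lerD.
(* Counting: each index [i] costs [eps ^+ 2], and [1 <= l i ^+ 2 / a ^+ 2]. *)
- rewrite (fp_sqn fp) mulrA mulrAC mulr_sumr ler_sum// => i Pi.
  rewrite (le_trans (diag i Pi))// -mulrA ler_peMr ?sqr_ge0// mulrC ler_pdivlMr ?exprn_gt0//.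
  by rewrite mul1r -[leRHS]real_normK ?num_real// lerXn2r ?nnegrE ?(ltW a0)// al.
- rewrite (fp_sqn fp) mulrA mulrAC mulr_sumr ler_sum// => i Pi.
  by rewrite mulrC ler_wpM2r ?sqr_ge0 ?res.
- rewrite (fp_sqn fp') mulrA mulrAC mulr_sumr ler_sum// => i Pi.
  by rewrite mulrC ler_wpM2r ?sqr_ge0 ?res'.
Qed.

Definition op_cvg (M : nat -> HH) K := forall eta : R, 0 < eta ->
  exists i0, forall i, (i0 <= i)%N -> opbound t (M i - K) eta.

End truncations.

(** * Operator norm convergence and convergence of the truncations *)

Section truncation_convergence.
Context {R : realType} {H HH : semiHilbert R} (t : H -> H -> HH).
Hypothesis tP : is_tensor t.
Implicit Types (K : HH) (M : nat -> HH).

(** Only the finitely many [|l k|] above [a] have to be avoided; the others are below [c - d]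
    because [a < c - d]. *)
Lemma gap_threshold K I l e (a b : R) : spec_dec t K I l e -> 0 < a -> a < b ->
  exists c d, [/\ a < c - d, c < b, 0 < d & forall k, I k -> d <= `| `|l k| - c|].
Proof.
move=> de a0 ab; have [n nP] := finitely_many_large tP de a0.
have [c [d [acd cb d0 sP]]] := avoid_finite [seq `|l k| | k <- iota 0 n] ab.
exists c, d; split=> // k Ik; have [kn|nk] := ltnP k n.
  by apply: sP; apply: map_f; rewrite mem_iota.
rewrite ler0_norm; first by have := nP k nk Ik; lra.
by have := nP k nk Ik; lra.
Qed.

(** One threshold is taken in each interval from [1 / (j + 2)] to [1 / (j + 1)]; disjointness of
    these makes the sequence strictly decreasing. The limit must serve every choice [N'] of
    truncations, since the selected representatives are only known to be truncations. *)
Theorem is_trunc_cvg M K (C : R) : hermitian_kernel t K ->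
  (forall i, sqn (M i) <= C) -> op_cvg t M K ->
  exists alpha : nat -> R, thresholds alpha /\ forall j, exists N : HH,
    forall N' : nat -> HH, (forall i, is_trunc t (M i) (alpha j) (N' i)) -> hcvg N' N.
Proof.
move=> hK MC MK; have [I [l [e de]]] := spectral_theorem tP hK.
have thr j : exists p : R * R, [/\ j.+2%:R^-1 < p.1 - p.2, p.1 < j.+1%:R^-1, 0 < p.2 &
    forall k, I k -> p.2 <= `| `|l k| - p.1|].
  have [||c [d h]] := @gap_threshold K I l e (j.+2%:R^-1) (j.+1%:R^-1) de.
  - by rewrite invr_gt0.
  - by rewrite ltf_pV2 ?posrE// ltr_nat.
  by exists (c, d).
have [p pP] := choice thr.
have p1_gt j : j.+2%:R^-1 < (p j).1.
  by have [h _ d0 _] := pP j; rewrite (lt_trans h)// ltrBlDr ltrDl.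
have p1_gt0 j : 0 < (p j).1 by rewrite (lt_trans _ (p1_gt j))// invr_gt0.
exists (fun j => (p j).1); split.
  split=> //.
    apply/decreasing_seqP => j; rewrite (lt_trans _ (p1_gt j))//.
    by have [] := pP j.+1.
  apply: null_seq_le null_seq_harmonic => j.
  by rewrite (ltW (p1_gt0 j)); have [_ /ltW] := pP j.
move=> j; have [ad ab d0 gap] := pP j.
set a := (p j).1 in ad ab gap *; set d := (p j).2 in ad d0 gap *.
have a0 : 0 < a by exact: p1_gt0.
have ad0 : 0 <= a - d by rewrite (le_trans _ (ltW ad))// invr_ge0.
pose P k := I k && (a < `|l k|).
have [||N NP] := @spec_sum_cvg _ _ _ t tP P l e (sqn K).
- by have [eON _] := de; move=> k i /andP[Ik _] /andP[Ii _]; exact: eON.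
- by move=> n; apply: (spec_dec_sum_le tP n de) => k /andP[].
(* No [|l k|] is closer to [a] than [d], so the rest of [K] has operator norm at most [a - d], while
   the retained [|l k|] are at least [a + d]. The distance [d] is thus available in both
   comparisons, although the spectrum of [M i] may have no gap at [a]. *)
have [|n fpK] := finite_part_ex tP de a0 ad0 _ NP.
  by move=> k Ik la; have := gap k Ik; rewrite ler0_norm; lra.
exists N => N' N'P; apply/null_seqP => eta eta0.
pose G := C / a ^+ 2 + C / d ^+ 2 + sqn N / d ^+ 2.
have C0 : 0 <= C by rewrite (le_trans _ (MC 0%N))// sqn_ge0.
have G0 : 0 <= G by rewrite !addr_ge0// divr_ge0 ?sqr_ge0 ?sqn_ge0.
(* Chosen for [(eta / (G + 1)) ^+ 2 * G < eta ^+ 2]; the added 1 also covers [G = 0]. *)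
have eps0 : 0 < eta / (G + 1) by rewrite divr_gt0// ltr_wpDl.
have [i0 i0P] := MK _ eps0; exists i0 => i /i0P MKi.
have [n' [P' [l' [e' [fpM l'a]]]]] := is_trunc_finite_part tP a0 (N'P i).
have := @sqn_finite_partB _ _ _ t tP _ _ _ _ _ _ a d _ _ _ _ _ _ _ _ _ hK fpM fpK.
move=> /(_ _ _ _ _ a0 d0 (ltW eps0) MKi) h.
rewrite ger0_norm ?nrm_ge0// -(@ltr_pXn2r _ 2)// ?nnegrE ?nrm_ge0 ?(ltW eta0)//.
rewrite sqr_nrm; apply: le_lt_trans (h _ _ _) _.
- by move=> k /l'a; rewrite subrK => /ltW.
- move=> k /andP[Ik la]; have := gap k Ik; rewrite ger0_norm; lra.
- by move=> k /l'a /ltW.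
have N'C : sqn (N' i) <= C by rewrite (le_trans (sqn_is_trunc_le tP a0 (N'P i))).
apply: (@le_lt_trans _ _ ((eta / (G + 1)) ^+ 2 * G)).
  rewrite ler_wpM2l ?sqr_ge0// /G !lerD// ler_wpM2r// invr_ge0 sqr_ge0//.
rewrite expr_div_n -mulrA gtr_pMr ?exprn_gt0// mulrC ltr_pdivrMr ?exprn_gt0 ?ltr_wpDl//.
by rewrite mul1r; nra.
Qed.

(** The same [K] is the [L_2] limit of [N] and the operator norm limit of [M]; this is what
    identifies the cut norm limit. In [M i - K = (M i - N' i j) + (N' i j - N j) + (N j - K)] the
    first term is at most [alpha j] uniformly in [i], so [j] is fixed before [i]. *)
Theorem op_cvg_of_is_trunc M (C : R) (alpha : nat -> R)
    (N' : nat -> nat -> HH) (N : nat -> HH) : thresholds alpha ->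
  (forall i, sqn (M i) <= C) ->
  (forall i j, is_trunc t (M i) (alpha j) (N' i j)) ->
  (forall j, hcvg (fun i => N' i j) (N j)) ->
  exists K, hcvg N K /\ op_cvg t M K.
Proof.
move=> [adec a0 al0] MC tr NP.
have sqn_cvg (u : nat -> HH) x : hcvg u x -> (fun i => sqn (u i)) @ \oo --> sqn x.
  move=> /hcvg_nrm h; under eq_fun do rewrite -sqr_nrm expr2.
  by rewrite -sqr_nrm expr2; exact: cvgM.
(* The Pythagorean identity for the truncations of each [M i] passes to the limit in [i]. *)
have incr m n : (m <= n)%N -> sqn (N n - N m) = sqn (N n) - sqn (N m).
  move=> mn; have h : hcvg (fun i => N' i n - N' i m) (N n - N m).
    apply: null_seq_le (null_seqD (NP n) (NP m)) => i; rewrite nrm_ge0/=.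
    have -> : N' i n - N' i m - (N n - N m) = (N' i n - N n) - (N' i m - N m).
      by rewrite !opprB addrACA [RHS]addrACA; congr (_ + _); rewrite addrC.
    exact: nrmB.
  have h2 := cvgB (sqn_cvg _ _ (NP n)) (sqn_cvg _ _ (NP m)).
  apply: (cvg_unique (@Rhausdorff R) (sqn_cvg _ _ h)).
  suff -> : (fun i => sqn (N' i n - N' i m)) = (fun i => sqn (N' i n) - sqn (N' i m)) by exact: h2.
  by apply/funext => i; rewrite (sqn_is_truncB tP (a0 n) _ (tr i n) (tr i m))// adec.
pose q j := sqn (N j).
have qC j : q j <= C.
  rewrite /q -(cvg_lim (@Rhausdorff R) (sqn_cvg _ _ (NP j))).
  apply: limr_le; first by apply: cvgP; exact: sqn_cvg (NP j).
  by near=> k; rewrite (le_trans (sqn_is_trunc_le tP (a0 j) (tr k j))).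
have qnd : nondecreasing_seq q by move=> m n mn; rewrite -subr_ge0 -incr// sqn_ge0.
have [||K KP] := @complete_increments _ _ N q.
- by apply: nondecreasing_is_cvgn => //; exists C => _ [n _ <-]; exact: qC.
- by move=> m n mn; rewrite incr// ler_norm.
exists K; split=> // eta eta0; have eta3 : 0 < eta / 3 by rewrite divr_gt0.
have /null_seqP/(_ _ eta3)[j1 j1P] := al0; have /null_seqP/(_ _ eta3)[j2 j2P] := KP.
pose j := maxn j1 j2.
have /null_seqP/(_ _ eta3)[i0 i0P] := NP j; exists i0 => i /i0P Nij.
have aj := j1P j (leq_maxl _ _); have Kj := j2P j (leq_maxr _ _).
have -> : M i - K = (M i - N' i j) + (N' i j - N j) + (N j - K).
  by rewrite !addrA !subrK.
apply: (@opbound_le _ _ _ t _ (alpha j + nrm (N' i j - N j) + nrm (N j - K))).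
  by move: aj Kj Nij; rewrite !ger0_norm ?nrm_ge0 ?(ltW (a0 j))//; lra.
apply: opboundD (opbound_nrm tP _); apply: opboundD (opbound_nrm tP _).
exact: is_trunc_opbound (a0 j) (tr i j).
Unshelve. all: end_near. Qed.

End truncation_convergence.

(** * The space of square integrable complex functions *)

Section complex_integrals.
Context d (T : measurableType d) (R : realType).
Variable mu : {measure set T -> \bar R}.
Implicit Types (f g h : T -> R[i]) (u v : T -> R).

Local Notation rintegrable u := (mu.-integrable [set: T] (EFin \o u)).

Lemma cmeasurable_cst (a : R[i]) : cmeasurable (fun _ : T => a).
Proof. by split; exact: measurable_cst. Qed.

Lemma cmeasurableD f g : cmeasurable f -> cmeasurable g ->
  cmeasurable (fun x => f x + g x).
Proof.
move=> [fr fi] [gr gi]; split.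
  have -> : (fun x => complex.Re (f x + g x)) =
    (fun x => complex.Re (f x) + complex.Re (g x)) by apply/funext => x; rewrite ReD.
  exact: measurable_funD.
have -> : (fun x => complex.Im (f x + g x)) =
    (fun x => complex.Im (f x) + complex.Im (g x)).
  by apply/funext => x; case: (f x) (g x) => [? ?] [].
exact: measurable_funD.
Qed.

Lemma cmeasurableM f g : cmeasurable f -> cmeasurable g ->
  cmeasurable (fun x => f x * g x).
Proof.
move=> [fr fi] [gr gi]; split.
  have -> : (fun x => complex.Re (f x * g x)) = (fun x => complex.Re (f x) * complex.Re (g x) -
      complex.Im (f x) * complex.Im (g x)).
    by apply/funext => x; case: (f x) (g x) => [? ?] [].
  by apply: measurable_funB; exact: measurable_funM.
have -> : (fun x => complex.Im (f x * g x)) = (fun x => complex.Re (f x) * complex.Im (g x) +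
    complex.Im (f x) * complex.Re (g x)).
  by apply/funext => x; case: (f x) (g x) => [? ?] [].
by apply: measurable_funD; exact: measurable_funM.
Qed.

Lemma cmeasurableJ f : cmeasurable f -> cmeasurable (fun x => conjc (f x)).
Proof.
move=> [fr fi]; split.
  by have -> : (fun x => complex.Re (conjc (f x))) = (fun x => complex.Re (f x))
    by apply/funext => x; case: (f x).
have -> : (fun x => complex.Im (conjc (f x))) = (fun x => - complex.Im (f x)).
  by apply/funext => x; case: (f x).
exact: measurable_funN.
Qed.

Lemma cmeasurable_modulus f : cmeasurable f ->
  measurable_fun [set: T] (fun x => modulus (f x)).
Proof.
move=> [fr fi].
have -> : (fun x => modulus (f x)) =
    (fun x => (complex.Re (f x) ^+ 2 + complex.Im (f x) ^+ 2) `^ 2^-1).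
  apply/funext => x; rewrite -sqr_modulus powR12_sqrt ?sqr_ge0//.
  by rewrite sqrtr_sqr ger0_norm ?modulus_ge0.
apply: (measurableT_comp (measurable_powR 2^-1)).
by apply: measurable_funD; exact: measurable_funX.
Qed.

Definition cintegrable h :=
  rintegrable (fun x => complex.Re (h x)) /\ rintegrable (fun x => complex.Im (h x)).

Lemma rintegrable_le u v : measurable_fun [set: T] u ->
  (forall x, `|u x| <= v x) -> rintegrable v -> rintegrable u.
Proof.
move=> mu_ uv; apply: le_integrable => //; first exact/measurable_EFinP.
by move=> x _ /=; rewrite lee_fin (le_trans (uv x))// ler_norm.
Qed.

Lemma rintegrableD u v : rintegrable u -> rintegrable v ->
  rintegrable (fun x => u x + v x).
Proof. by move=> iu iv; apply: eq_integrable (integrableD measurableT iu iv). Qed.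

Lemma rintegrableZ (c : R) u : rintegrable u -> rintegrable (fun x => c * u x).
Proof. by move=> iu; apply: eq_integrable (integrableZl measurableT c iu). Qed.

Lemma cintegrable_measurable h : cintegrable h -> cmeasurable h.
Proof.
by case=> /integrableP[hr _] /integrableP[hi _]; split; exact/measurable_EFinP.
Qed.

Lemma cintegrable_le h v : cmeasurable h -> (forall x, modulus (h x) <= v x) ->
  rintegrable v -> cintegrable h.
Proof.
move=> [hr hi] hv iv; split; apply: rintegrable_le iv => // x.
  exact: le_trans (normr_Re_le _) (hv x).
exact: le_trans (normr_Im_le _) (hv x).
Qed.

Lemma rintegrable_modulus h : cintegrable h -> rintegrable (fun x => modulus (h x)).
Proof.
move=> ih; have [hr hi] := ih.
apply: (@rintegrable_le _ (fun x => `|complex.Re (h x)| + `|complex.Im (h x)|)).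
- exact/cmeasurable_modulus/cintegrable_measurable.
- by move=> x; rewrite ger0_norm ?modulus_ge0// modulus_le_ReIm.
- by apply: rintegrableD; [exact: (integrable_abse hr)|exact: (integrable_abse hi)].
Qed.

Lemma cintegralD h g : cintegrable h -> cintegrable g ->
  cintegral mu (fun x => h x + g x) = cintegral mu h + cintegral mu g.
Proof.
move=> [hr hi] [gr gi]; rewrite /cintegral; apply/eqP; rewrite eq_complex/=.
rewrite -!RintegralD//; apply/andP; split; apply/eqP; apply: eq_Rintegral => x _.
  by rewrite ReD.
by case: (h x) (g x) => [? ?] [].
Qed.

Lemma cintegralZ (a : R[i]) h : cintegrable h ->
  cintegral mu (fun x => a * h x) = a * cintegral mu h.
Proof.
move=> [hr hi]; rewrite /cintegral; case: a => p q; apply/eqP; rewrite eq_complex/=.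
rewrite -!RintegralZl// -RintegralB ?rintegrableZ// -RintegralD ?rintegrableZ//.
by apply/andP; split; apply/eqP; apply: eq_Rintegral => x _; case: (h x).
Qed.

Lemma cintegralJ h : cintegrable h ->
  cintegral mu (fun x => conjc (h x)) = conjc (cintegral mu h).
Proof.
move=> [hr hi]; rewrite /cintegral /=; congr Complex.
  by apply: eq_Rintegral => x _; case: (h x).
transitivity (\int[mu]_x (- 1 * complex.Im (h x))).
  by apply: eq_Rintegral => x _; case: (h x) => p q /=; rewrite mulN1r.
by rewrite RintegralZl// mulN1r.
Qed.

Lemma eq_cintegral h g : (forall x, h x = g x) -> cintegral mu h = cintegral mu g.
Proof. by move=> hg; congr cintegral; apply/funext. Qed.

(** Real and imaginary parts are estimated separately; the factor 2 is not sharp and only affects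
    constants. *)
Lemma modulus_cintegral_le h : cintegrable h ->
  modulus (cintegral mu h) <= 2 * \int[mu]_x modulus (h x).
Proof.
move=> ih; have [hr hi] := ih; have im := rintegrable_modulus ih.
rewrite (le_trans (modulus_le_ReIm _))//= mulr2n mulrDl mul1r lerD//.
  rewrite (le_trans (le_normr_Rintegral _ hr))//; apply: le_Rintegral => //.
    exact: (integrable_abse hr).
  by move=> x _; exact: normr_Re_le.
rewrite (le_trans (le_normr_Rintegral _ hi))//; apply: le_Rintegral => //.
  exact: (integrable_abse hi).
by move=> x _; exact: normr_Im_le.
Qed.

Lemma ae_eq_Rintegral u v : measurable_fun [set: T] u -> measurable_fun [set: T] v ->
  (\forall x \ae mu, u x = v x) -> \int[mu]_x u x = \int[mu]_x v x.
Proof.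
move=> mu_ mv uv; congr fine; apply: ae_eq_integral => //; try exact/measurable_EFinP.
by apply: filterS uv => x -> _.
Qed.

Lemma ae_eq_cintegral h g : cmeasurable h -> cmeasurable g ->
  (\forall x \ae mu, h x = g x) -> cintegral mu h = cintegral mu g.
Proof.
move=> [hr hi] [gr gi] hg; congr Complex; apply: ae_eq_Rintegral => //.
  by apply: filterS hg => x ->.
by apply: filterS hg => x ->.
Qed.

Lemma cLnorm2E f : cLnorm mu 2%:E f =
  ((\int[mu]_x (modulus (f x) ^+ 2)%:E) `^ 2^-1)%E.
Proof.
rewrite /cLnorm unlock; congr (_ `^ _)%E; apply: eq_integral => x _ /=.
rewrite ger0_norm ?modulus_ge0// -powR_mulrn ?modulus_ge0//.
Qed.

Lemma inL2P f : inL2 mu f <->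
  cmeasurable f /\ rintegrable (fun x => modulus (f x) ^+ 2).
Proof.
split=> [[mf]|[mf /integrableP[_]]]; rewrite ?cLnorm2E => fin; split=> //.
  apply/integrableP; split.
    by apply/measurable_EFinP/measurable_funX/cmeasurable_modulus.
  rewrite (eq_integral (fun x => (modulus (f x) ^+ 2)%:E)) => [|x _]; last first.
    by rewrite /= ger0_norm ?sqr_ge0.
  by apply: lty_poweRy fin; rewrite invr_eq0.
rewrite cLnorm2E; apply: poweR_lty.
move: fin; rewrite (eq_integral (fun x => (modulus (f x) ^+ 2)%:E)) => [//|x _].
by rewrite /= ger0_norm ?sqr_ge0.
Qed.

Lemma inL2_mul f g : inL2 mu f -> inL2 mu g ->
  cintegrable (fun x => conjc (f x) * g x).
Proof.
move=> /inL2P[mf i_f] /inL2P[mg ig].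
apply: (@cintegrable_le _ (fun x => modulus (f x) ^+ 2 + modulus (g x) ^+ 2)).
- by apply: cmeasurableM => //; exact: cmeasurableJ.
- move=> x; rewrite modulusM modulusJ.
  have := sqr_ge0 (modulus (f x) - modulus (g x)).
  have := modulus_ge0 (f x); have := modulus_ge0 (g x); rewrite sqrrB.
  by move: (modulus _) (modulus _) => p q; nra.
- exact: rintegrableD.
Qed.

Lemma inL2D f g : inL2 mu f -> inL2 mu g -> inL2 mu (fun x => f x + g x).
Proof.
move=> /inL2P[mf i_f] /inL2P[mg ig]; apply/inL2P; split; first exact: cmeasurableD.
apply: (@rintegrable_le _ (fun x => 2 * (modulus (f x) ^+ 2 + modulus (g x) ^+ 2))).
- by apply/measurable_funX/cmeasurable_modulus; exact: cmeasurableD.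
- move=> x; rewrite ger0_norm ?sqr_ge0//.
  apply: (@le_trans _ _ ((modulus (f x) + modulus (g x)) ^+ 2)).
    by rewrite lerXn2r ?nnegrE ?addr_ge0 ?modulus_ge0// modulusD.
  have := sqr_ge0 (modulus (f x) - modulus (g x)); rewrite sqrrB sqrrD.
  by move: (modulus _) (modulus _) => p q; nra.
- by apply: rintegrableZ; exact: rintegrableD.
Qed.

Lemma inL2Z (a : R[i]) f : inL2 mu f -> inL2 mu (fun x => a * f x).
Proof.
move=> /inL2P[mf i_f]; apply/inL2P; split.
  by apply: cmeasurableM => //; exact: cmeasurable_cst.
have := rintegrableZ (modulus a ^+ 2) i_f.
by congr (integrable _ _ (_ \o _)); apply/funext => x; rewrite modulusM exprMn.
Qed.

Lemma inL2_0 : inL2 mu (fun=> 0).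
Proof.
apply/inL2P; split; first exact: cmeasurable_cst.
rewrite (_ : EFin \o _ = cst 0%E); first exact: integrable0.
by apply/funext => x /=; rewrite expr0n/= addr0 sqrtr0 expr0n.
Qed.

End complex_integrals.

(** * Completeness of [L_2] for a measure of total mass 1 *)

Section completeness.
Context d (T : measurableType d) (R : realType).
Variable mu : {measure set T -> \bar R}.
Hypothesis mu1 : mu [set: T] = 1%E.

Lemma cvg_summable_increments (w D : nat -> R) :
  (forall k, `|w k.+1 - w k| <= D k) -> cvgn (series D) -> cvgn w.
Proof.
move=> wD cD; pose s k := w k.+1 - w k.
have cs : cvgn (series s).
  apply: normed_cvg; apply: (series_le_cvg _ _ wD cD) => k.
    exact: normr_ge0.
  exact: le_trans (normr_ge0 _) (wD k).
have -> : w = (fun n => w 0%N + series s n).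
  by apply/funext => n; rewrite /series/= telescope_sumr// addrC subrK.
by apply: is_cvgD => //; exact: is_cvg_cst.
Qed.

Lemma limn_einf_le (u b : (\bar R)^nat) (l : \bar R) :
  (forall n, (u n <= b n)%E) -> b @ \oo --> l -> (limn_einf u <= l)%E.
Proof.
move=> ub /cvg_limn_einf_sup[<- _]; rewrite !limn_einf_lim.
apply: lee_lim; [exact: is_cvg_einfs|exact: is_cvg_einfs|].
apply: nearW => n; apply: le_ereal_inf_tmp => _ [m /= nm <-].
by apply: le_trans (ub m); apply: ereal_inf_lbound; exists m.
Qed.

Lemma EFin_Rintegral (u : T -> R) : mu.-integrable [set: T] (EFin \o u) ->
  (\int[mu]_x u x)%:E = (\int[mu]_x (u x)%:E)%E.
Proof. by move=> iu; rewrite fineK//; exact: integrable_fin_num. Qed.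

(** Riesz-Fischer: a fast subsequence [v] has increments summable in [L_1], hence converges almost
    everywhere, and Fatou transfers the Cauchy bound to the limit, for the whole sequence. *)
Theorem inL2_complete (u : nat -> T -> R[i]) (a : nat -> R) : (forall n, inL2 mu (u n)) ->
  null_seq a ->
  (forall m n, \int[mu]_x (modulus (u m x - u n x) ^+ 2) <= a m + a n) ->
  exists g, inL2 mu g /\
    null_seq (fun n => \int[mu]_x (modulus (u n x - g x) ^+ 2)).
Proof.
move=> uL a0 ua.
have inL2B f g : inL2 mu f -> inL2 mu g -> inL2 mu (fun x => f x - g x).
  move=> fL gL; have := inL2D fL (inL2Z (-1) gL).
  by congr inL2; apply/funext => x; rewrite mulN1r.
(* These sum to 1. *)
pose e k : R := 1 / (2 ^ k.+1)%:R.
have e0 k : 0 < e k by rewrite divr_gt0// ltr0n expn_gt0.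
have /choice[N NP] : forall k, exists N, forall n, (N <= n)%N -> `|a n| < e k ^+ 2 / 2.
  by move=> k; have /null_seqP := a0; apply; rewrite divr_gt0// exprn_gt0.
(* Summing the [N i] makes [phi] nondecreasing as well as at least [N k]. *)
pose phi k := (\sum_(i < k.+1) N i)%N.
have phiN k : (N k <= phi k)%N by rewrite /phi big_ord_recr leq_addl.
have phiS k : (phi k <= phi k.+1)%N by rewrite /phi [leqRHS]big_ord_recr leq_addr.
pose v k := u (phi k).
pose D k x := modulus (v k.+1 x - v k x).
have D2L k : inL2 mu (fun x => v k.+1 x - v k x) by apply: inL2B; exact: uL.
have D2i k : mu.-integrable [set: T] (EFin \o (fun x => D k x ^+ 2)).
  by have /inL2P[] := D2L k.
have mD k : measurable_fun [set: T] (D k).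
  by apply: cmeasurable_modulus; have /inL2P[] := D2L k.
have D_ge0 k x : 0 <= D k x by exact: modulus_ge0.
have D2e k : \int[mu]_x (D k x ^+ 2) <= e k ^+ 2.
  apply: le_trans (ua _ _) _.
  have := NP k _ (leq_trans (phiN k) (phiS k)); have := NP k _ (phiN k).
  have := ler_norm (a (phi k)); have := ler_norm (a (phi k.+1)); lra.
(* From [D <= D ^+ 2 / (2 e) + e / 2] and total mass 1, in place of Cauchy-Schwarz. *)
have De k : (\int[mu]_x (D k x)%:E <= (e k)%:E)%E.
  pose h x := (2 * e k)^-1 * D k x ^+ 2 + 2^-1 * e k.
  have hi1 := rintegrableZ (2 * e k)^-1 (D2i k).
  have ci : mu.-integrable [set: T] (EFin \o (fun _ : T => 2^-1 * e k)).
    apply/integrableP; split; first exact/measurable_EFinP/measurable_cst.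
    by rewrite [ltLHS](integral_cst mu measurableT `|(2^-1 * e k)%:E|%E) mu1 mule1 ltry.
  have hi : mu.-integrable [set: T] (EFin \o h) by exact: rintegrableD.
  apply: (@le_trans _ _ (\int[mu]_x (h x)%:E)%E).
    apply: ge0_le_integral => //.
    - by move=> x _; rewrite lee_fin.
    - exact/measurable_EFinP.
    - by have /integrableP[] := hi.
    - move=> x _; rewrite lee_fin /h -subr_ge0.
      have -> : (2 * e k)^-1 * D k x ^+ 2 + 2^-1 * e k - D k x =
          (2 * e k)^-1 * (D k x - e k) ^+ 2 by field; rewrite gt_eqF.
      by rewrite mulr_ge0 ?sqr_ge0// invr_ge0 mulr_ge0// ltW.
  rewrite -EFin_Rintegral// lee_fin /h RintegralD// RintegralZl// Rintegral_cst// mu1 mulr1.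
  apply: (@le_trans _ _ ((2 * e k)^-1 * e k ^+ 2 + 2^-1 * e k)).
    by rewrite lerD2r ler_wpM2l// invr_ge0 mulr_ge0// ltW.
  by rewrite le_eqVlt; apply/orP; left; apply/eqP; field; rewrite gt_eqF.
pose G x := (\sum_(k <oo) (D k x)%:E)%E.
have mG : measurable_fun [set: T] G.
  by apply: ge0_emeasurable_sum => [k x _ _|k _]; [rewrite lee_fin|exact/measurable_EFinP].
have Gi : mu.-integrable [set: T] G.
  apply/integrableP; split=> //.
  rewrite (eq_integral G) => [|x _]; last first.
    by rewrite gee0_abs//; apply: nneseries_ge0 => k _ _; rewrite lee_fin.
  rewrite integral_nneseries//; last by move=> k x _; rewrite lee_fin.
    2: by move=> k; exact/measurable_EFinP.
  apply: (@le_lt_trans _ _ 1%E); last exact: ltry.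
  apply: le_trans (epsilon_trick0 xpredT (@ler01 R)).
  by apply: lee_nneseries => k *; [apply: integral_ge0 => x _; rewrite lee_fin|exact: De].
have good : \forall x \ae mu, cvgn (series (D^~ x)).
  have := integrable_ae measurableT Gi; apply: filterS => x /(_ I) Gx.
  apply: nondecreasing_is_cvgn.
    apply/nondecreasing_seqP => n; rewrite /series/= big_nat_recr//= lerDl//.
  exists (fine (G x)) => _ [n _ <-]; rewrite -lee_fin fineK// /series/= -sumEFin.
  by apply: nneseries_lim_ge => k _ _; rewrite lee_fin.
(* The upper limit is measurable without any convergence, and equals the limit at almost every
   point. *)
pose gr x := fine (limn_esup (fun k => (complex.Re (v k x))%:E)).
pose gi x := fine (limn_esup (fun k => (complex.Im (v k x))%:E)).
pose g x := Complex (gr x) (gi x).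
have vm k : cmeasurable (v k) by have /inL2P[] := uL (phi k).
have gm : cmeasurable g.
  split.
    apply: (measurableT_comp (f := fine)) => //; apply: measurable_fun_limn_esup => k.
    by apply/measurable_EFinP; have [] := vm k.
  apply: (measurableT_comp (f := fine)) => //; apply: measurable_fun_limn_esup => k.
  by apply/measurable_EFinP; have [] := vm k.
have lim_fine (w : nat -> R) : cvgn w -> w @ \oo --> fine (limn_esup (EFin \o w)).
  move=> /cvg_ex[l wl].
  have /cvg_limn_einf_sup[_ ->] : (EFin \o w) @ \oo --> l%:E by apply: cvg_EFin => //; exact: nearW.
  exact: wl.
have vg : \forall x \ae mu, (fun k => complex.Re (v k x)) @ \oo --> complex.Re (g x) /\
    (fun k => complex.Im (v k x)) @ \oo --> complex.Im (g x).
  apply: filterS good => x cD; split; apply: lim_fine.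
    apply: cvg_summable_increments cD => k; rewrite -ReB; exact: normr_Re_le.
  apply: cvg_summable_increments cD => k.
  have -> : complex.Im (v k.+1 x) - complex.Im (v k x) = complex.Im (v k.+1 x - v k x).
    by case: (v k.+1 x) (v k x) => [? ?] [].
  exact: normr_Im_le.
have gum n : cmeasurable (fun x => g x - u n x).
  have un : cmeasurable (u n) by have /inL2P[] := uL n.
  have := cmeasurableD gm (cmeasurableM (cmeasurable_cst T (-1)) un).
  by congr cmeasurable; apply/funext => x; rewrite mulN1r.
(* Fatou along [k]: the integrals for [v k - u n] are at most [|a (phi k)| + a n], which tends to
   [a n]. *)
have fatou_bound n : (\int[mu]_x (modulus (g x - u n x) ^+ 2)%:E <= (a n)%:E)%E.
  pose F k x : \bar R := (modulus (v k x - u n x) ^+ 2)%:E.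
  have FL k : inL2 mu (fun x => v k x - u n x) by apply: inL2B; exact: uL.
  have Fm k : measurable_fun [set: T] (F k).
    by apply/measurable_EFinP/measurable_funX/cmeasurable_modulus; have /inL2P[] := FL k.
  have -> : (\int[mu]_x (modulus (g x - u n x) ^+ 2)%:E = \int[mu]_x limn_einf (F ^~ x))%E.
    apply: ae_eq_integral => //.
    - exact/measurable_EFinP/measurable_funX/cmeasurable_modulus.
    - apply: measurableT_comp => //; apply: measurable_fun_limn_esup => k.
      exact: measurableT_comp.
    - apply: filterS vg => x [vr vi] _; apply/esym.
      have [|-> _//] := @cvg_limn_einf_sup _ (F^~ x) (modulus (g x - u n x) ^+ 2)%:E.
      apply: cvg_EFin; first exact: nearW.
      rewrite (_ : fine \o _ = fun k => (complex.Re (v k x) - complex.Re (u n x)) ^+ 2 +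
        (complex.Im (v k x) - complex.Im (u n x)) ^+ 2); last first.
        by apply/funext => k /=; rewrite sqr_modulus; case: (v k x) (u n x) => [? ?] [].
      have -> : modulus (g x - u n x) ^+ 2 = (complex.Re (g x) - complex.Re (u n x)) ^+ 2 +
          (complex.Im (g x) - complex.Im (u n x)) ^+ 2.
        by rewrite sqr_modulus; case: (g x) (u n x) => [? ?] [].
      by apply: cvgD; rewrite expr2; under eq_fun do rewrite expr2;
        apply: cvgM; apply: cvgB => //; exact: cvg_cst.
  have F0 k x : [set: T] x -> (0 <= F k x)%E by move=> _; rewrite lee_fin sqr_ge0.
  apply: le_trans (fatou mu measurableT Fm F0) _.
  apply: (@limn_einf_le _ (fun k => (`|a (phi k)| + a n)%:E)).
    move=> k; have /inL2P[_ Fi] := FL k.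
    rewrite -EFin_Rintegral// lee_fin (le_trans (ua _ _))// lerD2r ler_norm.
    by [].
  apply: cvg_EFin; first exact: nearW.
  rewrite -[X in _ --> X]add0r; apply: cvgD; last exact: cvg_cst.
  apply: null_seq_le null_seq_harmonic => k; rewrite normr_ge0/=.
  apply: (@le_trans _ _ (e k)).
    rewrite (le_trans (ltW (NP k _ (phiN k))))// expr2 -mulrA ler_piMr ?(ltW (e0 k))//.
    have : e k <= 1 by rewrite /e ler_pdivrMr ?ltr0n ?expn_gt0// mul1r ler1n expn_gt0.
    by have := e0 k; lra.
  by rewrite /e div1r lef_pV2 ?posrE ?ltr0n ?expn_gt0// ler_nat ltnW// ltn_expl.
have guL n : inL2 mu (fun x => g x - u n x).
  apply/inL2P; split=> //; apply/integrableP; split.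
    exact/measurable_EFinP/measurable_funX/cmeasurable_modulus.
  apply: le_lt_trans (ltry (a n)); apply: le_trans (fatou_bound n).
  rewrite le_eqVlt; apply/orP; left; apply/eqP; apply: eq_integral => x _.
  by rewrite gee0_abs// lee_fin sqr_ge0.
exists g; split.
  have := inL2D (guL 0%N) (uL 0%N).
  by congr inL2; apply/funext => x; rewrite subrK.
apply: null_seq_le a0 => n; rewrite Rintegral_ge0 => [/=|x _]; last exact: sqr_ge0.
have /inL2P[_ gi2] := guL n; rewrite -lee_fin.
apply: le_trans (fatou_bound n); rewrite -EFin_Rintegral// lee_fin le_eqVlt.
by apply/orP; left; apply/eqP; apply: eq_Rintegral => x _; rewrite -modulusN opprB.
Qed.

End completeness.

(** * The semi-Hilbert space of square integrable functions *)

Section L2_space.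
Context d (T : measurableType d) (R : realType).
Variable mu : {measure set T -> \bar R}.

(** As a submodule of all functions, the space inherits its operations pointwise, and equality in it
    is equality of functions. *)
Definition L2pred : {pred T -> R[i]} := mem [set f | inL2 mu f].

Lemma L2_submod_closed : submod_closed L2pred.
Proof.
split; first by rewrite inE; exact: inL2_0.
move=> a f g; rewrite !inE => fL gL; exact: (inL2D (inL2Z a fL) gL).
Qed.

HB.instance Definition _ := GRing.isSubmodClosed.Build R[i] (T -> R[i]) L2pred L2_submod_closed.

Record L2fun := MkL2 { l2val :> T -> R[i]; _ : l2val \in L2pred }.
HB.instance Definition _ := [isSub of L2fun for l2val].
HB.instance Definition _ := [Choice of L2fun by <:].
HB.instance Definition _ := [SubChoice_isSubLmodule of L2fun by <:].

Lemma L2funP (f : L2fun) : inL2 mu f.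
Proof. by case: f => f /=; rewrite inE. Qed.

Lemma mkL2_proof (f : T -> R[i]) : inL2 mu f -> f \in L2pred.
Proof. by move=> h; rewrite inE. Qed.

Definition mkL2 (f : T -> R[i]) (h : inL2 mu f) : L2fun := MkL2 (mkL2_proof h).


Lemma Re_inner_self (f : T -> R[i]) :
  complex.Re (inner mu f f) = \int[mu]_x (modulus (f x) ^+ 2).
Proof. by apply: eq_Rintegral => x _; rewrite mulJc. Qed.

Lemma inner_conj (f g : L2fun) : inner mu f g = conjc (inner mu g f).
Proof.
rewrite /inner -cintegralJ; last by apply: inL2_mul; exact: L2funP.
by apply: eq_cintegral => x; rewrite rmorphM/= conjcK mulrC.
Qed.

Lemma innerDr (f g h : L2fun) : inner mu f (g + h) = inner mu f g + inner mu f h.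
Proof.
rewrite /inner -cintegralD; try by apply: inL2_mul; exact: L2funP.
by apply: eq_cintegral => x; rewrite -mulrDr.
Qed.

Lemma innerZr (a : R[i]) (f g : L2fun) : inner mu f (a *: g) = a * inner mu f g.
Proof.
rewrite /inner -cintegralZ; last by apply: inL2_mul; exact: L2funP.
by apply: eq_cintegral => x; rewrite mulrCA.
Qed.

Lemma inner_self_ge0 (f : L2fun) : 0 <= complex.Re (inner mu f f).
Proof. by rewrite Re_inner_self Rintegral_ge0// => x _; exact: sqr_ge0. Qed.

Hypothesis mu1 : mu [set: T] = 1%E.

Lemma inner_complete (u : nat -> L2fun) (a : nat -> R) : null_seq a ->
  (forall m n, complex.Re (inner mu (u m - u n) (u m - u n)) <= a m + a n) ->
  exists x : L2fun, null_seq (fun n => complex.Re (inner mu (u n - x) (u n - x))).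
Proof.
move=> a0 ua; have [|g [gL ug]] := inL2_complete mu1 (fun n => L2funP (u n)) a0.
  by move=> m n; rewrite -[leLHS](Re_inner_self (u m - u n)); exact: ua.
exists (mkL2 gL); move: ug; congr null_seq; apply/funext => n.
by rewrite Re_inner_self.
Qed.

Definition L2 : semiHilbert R := @SemiHilbert R L2fun (fun f g => inner mu f g)
  innerDr innerZr inner_conj inner_self_ge0 inner_complete.

Lemma cLnorm_nrm (f : L2) : cLnorm mu 2%:E (f : L2fun) = (nrm f)%:E.
Proof.
have /inL2P[_ i_f] := L2funP f.
rewrite cLnorm2E -EFin_Rintegral// poweR_EFin powR12_sqrt; last first.
  by rewrite Rintegral_ge0// => x _; exact: sqr_ge0.
congr (Num.sqrt _)%:E; exact/esym/Re_inner_self.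
Qed.

Lemma L2cvg_hcvg (u : nat -> L2) (g : L2) :
  L2cvg mu (fun n => u n : L2fun) (g : L2fun) <-> hcvg u g.
Proof.
have E : (fun n => cLnorm mu 2%:E (fun x => (u n : L2fun) x - (g : L2fun) x)) =
    EFin \o (fun n => nrm (u n - g)).
  by apply/funext => n; exact: (cLnorm_nrm (u n - g)).
split=> [[_]|h]; first by rewrite E => /fine_cvgP[_].
split; first exact: L2funP.
by rewrite E; apply: cvg_EFin => //; exact: nearW.
Qed.

End L2_space.

(** * Kernels as tensors *)

Section product_integrals.
Context d (V : measurableType d) (R : realType) (mu : probability V R).
Local Notation mu2 := (mu \x mu)%E.
Implicit Types (p q : V -> R).

Lemma rintegrable_prod p q : mu.-integrable [set: V] (EFin \o p) ->
  mu.-integrable [set: V] (EFin \o q) ->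
  mu2.-integrable [set: V * V] (EFin \o (fun z => p z.1 * q z.2)).
Proof.
move=> ip_ iq; have /integrableP[mp fp] := ip_; have /integrableP[mq fq] := iq.
apply/integrable12ltyP.
  apply/measurable_EFinP; apply: measurable_funM.
    apply: (measurableT_comp (f := p)); last exact: measurable_fst.
    exact/measurable_EFinP.
  apply: (measurableT_comp (f := q)); last exact: measurable_snd.
  exact/measurable_EFinP.
rewrite (eq_integral (fun x => (`|p x|%:E * \int[mu]_y `|(q y)%:E|)%E)) => [|x _]; last first.
  rewrite -ge0_integralZl//; last exact: measurableT_comp.
  by apply: eq_integral => y _ /=; rewrite normrM EFinM.
have qfin : (\int[mu]_y `|(q y)%:E|)%E \is a fin_num.
  by rewrite ge0_fin_numE ?integral_ge0.
rewrite -(fineK qfin) ge0_integralZr//.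
- rewrite -(fineK (_ : \int[mu]_x `|p x|%:E \is a fin_num)%E) -?EFinM ?ltry//.
  by rewrite ge0_fin_numE ?integral_ge0// => x _; rewrite lee_fin.
- by apply/measurable_EFinP; apply: measurableT_comp => //; exact/measurable_EFinP.
- by rewrite lee_fin fine_ge0 ?integral_ge0.
Qed.

Lemma Rintegral_prod p q : mu.-integrable [set: V] (EFin \o p) ->
  mu.-integrable [set: V] (EFin \o q) ->
  \int[mu2]_z (p z.1 * q z.2) = (\int[mu]_x p x) * (\int[mu]_y q y).
Proof.
move=> ip_ iq; have ipq := rintegrable_prod ip_ iq.
apply: EFin_inj; rewrite EFin_Rintegral// EFinM.
rewrite -(integral12_prod_meas1 ipq) (eq_integral (fun x => ((p x)%:E * (\int[mu]_y q y)%:E)%E)).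
  by rewrite integralZr// -EFin_Rintegral.
move=> x _; rewrite EFin_Rintegral// -integralZl//.
Qed.

Lemma cintegral_prod (p q : V -> R[i]) : cintegrable mu p -> cintegrable mu q ->
  cintegral mu2 (fun z => p z.1 * q z.2) = cintegral mu p * cintegral mu q.
Proof.
move=> [pr pi] [qr qi]; rewrite /cintegral; apply/eqP; rewrite eq_complex/=.
rewrite -(Rintegral_prod pr qr) -(Rintegral_prod pi qi).
rewrite -(Rintegral_prod pr qi) -(Rintegral_prod pi qr).
rewrite -(RintegralB _ (rintegrable_prod pr qr) (rintegrable_prod pi qi))//.
rewrite -(RintegralD _ (rintegrable_prod pr qi) (rintegrable_prod pi qr))//.
by apply/andP; split; apply/eqP; apply: eq_Rintegral => z _; case: (p z.1) (q z.2) => [? ?] [].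
Qed.

(** The measurable sets over which [h] has integral 0 form a Dynkin class containing the rectangles,
    which are stable under intersection and generate the product sigma-algebra. *)
Lemma rectangles_ae0 (h : V * V -> R) : mu2.-integrable [set: V * V] (EFin \o h) ->
  (forall A B, measurable A -> measurable B -> \int[mu2]_(z in A `*` B) h z = 0) ->
  \forall z \ae mu2, h z = 0.
Proof.
move=> ih rect.
have ihE E : measurable E -> mu2.-integrable E (EFin \o h).
  by move=> mE; exact: integrableS ih.
suff all0 E : measurable E -> (\int[mu2]_(z in E) (h z)%:E = 0)%E.
  have : ae_eq mu2 [set: V * V] (EFin \o h) (cst 0%E).
    apply: integral_ae_eq => // E _ mE; rewrite integral0; exact: all0.
  by apply: filterS => z /(_ I) [].
move=> mE.
pose P := [set E | measurable E /\ (\int[mu2]_(z in E) (h z)%:E = 0)%E].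
suff [] : P E by [].
have ihfin E' : measurable E' -> (\int[mu2]_(z in E') (h z)%:E)%E \is a fin_num.
  by move=> mE'; apply: integrable_fin_num => //; exact: ihE.
have rect0 A B : measurable A -> measurable B -> P (A `*` B).
  move=> mA mB; split; first exact: measurableX.
  by rewrite -(fineK (ihfin _ (measurableX mA mB))) -[fine _]/(Rintegral _ _ _) rect.
have PT : P [set: V * V] by rewrite -setXTT; exact: rect0.
move: mE; rewrite measurable_prod_measurableType.
apply: dynkin_induction => //.
- exact: measurable_prod_measurableType.
- move=> _ _ [A1 mA1 [B1 mB1 <-]] [A2 mA2 [B2 mB2 <-]].
  rewrite -setXI; exists (A1 `&` A2); first exact: measurableI.
  by exists (B1 `&` B2) => //; exact: measurableI.
- by move=> _ [A mA [B mB <-]]; exact: rect0.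
- move=> S mS [_ S0]; split; first exact: measurableC.
  have [_] := PT; rewrite -(setUv S) integral_setU//.
  + by rewrite S0 add0e.
  + exact: measurableC.
  + by rewrite setUv; have /integrableP[] := ih.
  + by apply/disj_setPS; rewrite setICr.
- move=> F mF tF PF; split; first exact: bigcup_measurable.
  rewrite integral_bigcup//; last first.
    by apply: ihE; exact: bigcup_measurable.
  by rewrite eseries0// => k _ _; have [] := PF k.
Qed.

End product_integrals.

Section bounded_functions.
Context d (T : measurableType d) (R : realType).
Variable mu : {measure set T -> \bar R}.
Hypothesis mu1 : mu [set: T] = 1%E.
Local Notation H := (L2 mu1).
Implicit Types (f : T -> R[i]).

Lemma sqn_L2 (f : H) : sqn f = \int[mu]_x (modulus ((f : L2fun mu) x) ^+ 2).
Proof. exact: Re_inner_self. Qed.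

Lemma integral_ae_le_sqr f (B : R) : cmeasurable f -> 0 <= B ->
  (\forall x \ae mu, modulus (f x) <= B) ->
  (\int[mu]_x (modulus (f x) ^+ 2)%:E <= (B ^+ 2)%:E)%E.
Proof.
move=> mf B0 fB; apply: (@le_trans _ _ (\int[mu]_x (B ^+ 2)%:E)%E); last first.
  by rewrite integral_cst// mu1 mule1.
apply: ae_ge0_le_integral => //.
- by move=> x _; rewrite lee_fin sqr_ge0.
- exact/measurable_EFinP/measurable_funX/cmeasurable_modulus.
- by move=> x _; rewrite lee_fin sqr_ge0.
- by apply: filterS fB => x fx _; rewrite lee_fin lerXn2r ?nnegrE ?modulus_ge0.
Qed.

Lemma inL2_bounded f (B : R) : cmeasurable f -> 0 <= B ->
  (\forall x \ae mu, modulus (f x) <= B) -> inL2 mu f.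
Proof.
move=> mf B0 fB; apply/inL2P; split=> //; apply/integrableP; split.
  exact/measurable_EFinP/measurable_funX/cmeasurable_modulus.
apply: le_lt_trans (ltry (B ^+ 2)); apply: le_trans (integral_ae_le_sqr mf B0 fB).
rewrite le_eqVlt; apply/orP; left; apply/eqP; apply: eq_integral => x _ /=.
by rewrite ger0_norm ?sqr_ge0.
Qed.

Lemma nrm_bounded (f : H) (B : R) : 0 <= B ->
  (\forall x \ae mu, modulus ((f : L2fun mu) x) <= B) -> nrm f <= B.
Proof.
move=> B0 fB; have /inL2P[mf fi] := L2funP f.
rewrite -(@ler_pXn2r _ 2)// ?nnegrE ?nrm_ge0// sqr_nrm sqn_L2 -lee_fin.
by rewrite EFin_Rintegral// integral_ae_le_sqr.
Qed.

Lemma cLnormy_le f (B : R) : (cLnorm mu +oo%E f <= B%:E)%E ->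
  \forall x \ae mu, modulus (f x) <= B.
Proof.
rewrite /cLnorm unlock mu1 lte01 => /ess_supP; apply: filterS => x /=.
by rewrite lee_fin ger0_norm// modulus_ge0.
Qed.

Lemma cLnormy_ge f (B : R) : (forall x, modulus (f x) <= B) ->
  (cLnorm mu +oo%E f <= B%:E)%E.
Proof.
move=> fB; rewrite /cLnorm unlock mu1 lte01; apply/ess_supP; apply: nearW => x /=.
by rewrite lee_fin ger0_norm// modulus_ge0.
Qed.

Lemma inL2_cst (a : R[i]) : inL2 mu (fun=> a).
Proof.
apply: (@inL2_bounded _ (modulus a)); [exact: cmeasurable_cst|exact: modulus_ge0|].
exact: nearW.
Qed.

Lemma inL2_cintegrable f : inL2 mu f -> cintegrable mu f.
Proof.
move=> fL; have := inL2_mul (inL2_cst 1) fL.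
by congr cintegrable; apply/funext => x; rewrite conjc1 mul1r.
Qed.

Lemma cmeasurable_indic (A : set T) : measurable A ->
  cmeasurable (fun x => rc (\1_A x) : R[i]).
Proof. by move=> mA; split; [exact: measurable_indic|exact: measurable_cst]. Qed.

Lemma modulus_indic_le (A : set T) x : modulus (rc (\1_A x) : R[i]) <= 1.
Proof. by rewrite modulus_rc indicE; case: (_ \in _); rewrite ?normr1 ?normr0. Qed.

Lemma inL2_indic (A : set T) : measurable A -> inL2 mu (fun x => rc (\1_A x)).
Proof.
move=> mA; apply: (@inL2_bounded _ 1) => //; first exact: cmeasurable_indic.
by apply: nearW => x; exact: modulus_indic_le.
Qed.

End bounded_functions.

Section tensor.
Context d (V : measurableType d) (R : realType) (mu : probability V R).
Local Notation mu2 := (mu \x mu)%E.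

Lemma mu2T : mu2 [set: V * V] = 1%E.
Proof. exact: probability_setT. Qed.

Local Notation H := (L2 (probability_setT mu)).
Local Notation HH := (L2 mu2T).

Lemma cmeasurable_fst (f : V -> R[i]) : cmeasurable f -> cmeasurable (fun z : V * V => f z.1).
Proof.
move=> [fr fi]; split.
  exact: (measurableT_comp fr measurable_fst).
exact: (measurableT_comp fi measurable_fst).
Qed.

Lemma cmeasurable_snd (f : V -> R[i]) : cmeasurable f -> cmeasurable (fun z : V * V => f z.2).
Proof.
move=> [fr fi]; split.
  exact: (measurableT_comp fr measurable_snd).
exact: (measurableT_comp fi measurable_snd).
Qed.

Lemma inL2_tensor (f g : V -> R[i]) : inL2 mu f -> inL2 mu g ->
  inL2 mu2 (fun z => f z.1 * conjc (g z.2)).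
Proof.
move=> /inL2P[mf fi] /inL2P[mg gi]; apply/inL2P; split.
  by apply: cmeasurableM; [exact: cmeasurable_fst|apply: cmeasurableJ; exact: cmeasurable_snd].
have := rintegrable_prod fi gi.
by congr (integrable _ _ (_ \o _)); apply/funext => z; rewrite modulusM modulusJ exprMn.
Qed.

Definition tens (f g : H) : HH := mkL2 (inL2_tensor (L2funP f) (L2funP g)).

Lemma L2fun_ext d' (T : measurableType d') (m : {measure set T -> \bar R}) (f g : L2fun m) :
  (forall x, f x = g x) -> f = g.
Proof. by move=> fg; apply: val_inj; apply/funext. Qed.

Lemma cintegrableJ d' (T : measurableType d') (m : {measure set T -> \bar R}) (h : T -> R[i]) :
  cintegrable m h -> cintegrable m (fun x => conjc (h x)).
Proof.
move=> ih; apply: (@cintegrable_le _ _ _ _ _ (fun x => modulus (h x))).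
- by apply: cmeasurableJ; exact: cintegrable_measurable ih.
- by move=> x; rewrite modulusJ.
- exact: rintegrable_modulus.
Qed.

Lemma ae0_nrm (M : HH) : (\forall z \ae mu2, (M : L2fun mu2) z = 0) -> nrm M = 0.
Proof.
move=> M0; apply/eqP; rewrite eq_le nrm_ge0 andbT; apply: nrm_bounded => //.
by apply: filterS M0 => z ->; rewrite ComplexField.Normc.normc0.
Qed.

(** Tensors of indicators are indicators of rectangles, so the integrals of the real and imaginary
    parts of [M] vanish over all rectangles. *)
Lemma tens_total (M : HH) : (forall f g, ip (tens f g) M = 0) -> nrm M = 0.
Proof.
move=> h; have [Mr Mi] := inL2_cintegrable mu2T (L2funP M).
have rect A B : measurable A -> measurable B ->
    cintegral mu2 (fun z => rc (\1_(A `*` B) z) * (M : L2fun mu2) z) = 0.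
  move=> mA mB.
  have := h (mkL2 (inL2_indic (probability_setT mu) mA))
    (mkL2 (inL2_indic (probability_setT mu) mB)).
  rewrite -[LHS]/(inner _ _ _) => <-; apply: eq_cintegral => z.
  rewrite -[tens _ _ z]/(rc (\1_A z.1) * conjc (rc (\1_B z.2))) rcJ -rcM rcJ.
  by rewrite !indicE in_setX; case: (z.1 \in A); case: (z.2 \in B); rewrite ?(mul0r,mulr0,mul1r).
have rer A B : measurable A -> measurable B ->
    \int[mu2]_(z in A `*` B) complex.Re ((M : L2fun mu2) z) = 0.
  move=> mA mB; rewrite Rintegral_mkcond; have [/esym -> _] := rect A B mA mB.
  apply: eq_Rintegral => z _; rewrite ReZ indicE /patch.
  by case: ifPn => zAB; rewrite ?mul1r ?mul0r.
have rei A B : measurable A -> measurable B ->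
    \int[mu2]_(z in A `*` B) complex.Im ((M : L2fun mu2) z) = 0.
  move=> mA mB; rewrite Rintegral_mkcond; have [_ /esym ->] := rect A B mA mB.
  apply: eq_Rintegral => z _; rewrite indicE /patch.
  by case: ifPn => zAB; case: ((M : L2fun mu2) z) => p q /=; rewrite ?mul1r ?mul0r ?addr0.
apply: ae0_nrm; apply: filterS2 (rectangles_ae0 Mr rer) (rectangles_ae0 Mi rei) => z.
by case: ((M : L2fun mu2) z) => p q /= -> ->.
Qed.

Lemma tens_is_tensor : is_tensor tens.
Proof.
split.
- by move=> f f' g; apply: L2fun_ext => z; exact: mulrDl.
- by move=> a f g; apply: L2fun_ext => z; rewrite -[RHS]/(a * (_ * _)) mulrA.
- move=> f g g'; apply: L2fun_ext => z.
  by rewrite -[RHS]/(_ * _ + _ * _) -mulrDr -rmorphD.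
- move=> a f g; apply: L2fun_ext => z.
  by rewrite -[RHS]/(_ * (_ * _)) mulrCA -rmorphM.
- move=> f g f' g'.
  rewrite -[LHS]/(inner _ _ _) -[ip f f']/(inner mu (f : L2fun mu) (f' : L2fun mu)).
  rewrite -[ip g' g]/(inner mu (g' : L2fun mu) (g : L2fun mu)).
  rewrite /inner -cintegral_prod; try by apply: inL2_mul; exact: L2funP.
  apply: eq_cintegral => z; rewrite -[tens f g z]/(_ * _) -[tens f' g' z]/(_ * _).
  by rewrite rmorphM/= conjcK mulrACA [X in _ * X]mulrC.
- exact: tens_total.
Qed.

Lemma sesqui_sform (f g : H) (M : HH) :
  Defs.sesqui mu (f : L2fun mu) (M : L2fun mu2) (g : L2fun mu) = sform tens M f g.
Proof.
apply: eq_cintegral => z; rewrite -[tens f g z]/(_ * _) rmorphM/= conjcK.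
by rewrite mulrAC.
Qed.

Lemma rintegrable_swap (h : V * V -> R) : mu2.-integrable [set: V * V] (EFin \o h) ->
  mu2.-integrable [set: V * V] (EFin \o (fun z => h (z.2, z.1))).
Proof.
move=> ih; have /integrableP[mh _] := ih; apply/integrable12ltyP.
  exact: (measurableT_comp mh (@measurable_swap _ _ V V)).
have /(integrable21ltyP mu mu mh) := ih.
by [].
Qed.

Lemma Rintegral_swap (h : V * V -> R) : mu2.-integrable [set: V * V] (EFin \o h) ->
  \int[mu2]_z h (z.2, z.1) = \int[mu2]_z h z.
Proof.
move=> ih; apply: EFin_inj; rewrite !EFin_Rintegral//; last exact: rintegrable_swap.
rewrite -(integral21_prod_meas1 ih) -(integral12_prod_meas1 (rintegrable_swap ih)).
by [].
Qed.

Lemma cintegrable_swap (h : V * V -> R[i]) : cintegrable mu2 h ->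
  cintegrable mu2 (fun z => h (z.2, z.1)).
Proof. by move=> [hr hi]; split; [exact: (rintegrable_swap hr)|exact: (rintegrable_swap hi)]. Qed.

Lemma cintegral_swap (h : V * V -> R[i]) : cintegrable mu2 h ->
  cintegral mu2 (fun z => h (z.2, z.1)) = cintegral mu2 h.
Proof.
by move=> [hr hi]; congr Complex; [exact: (Rintegral_swap hr)|exact: (Rintegral_swap hi)].
Qed.

(** Exchanging the two variables by Fubini makes the integrands of the two sides agree almost
    everywhere. *)
Lemma self_adjoint_hermitian (M : HH) : self_adjoint mu (M : L2fun mu2) ->
  hermitian_kernel tens M.
Proof.
move=> Msa f g; rewrite -!sesqui_sform.
pose F (u v : H) z := conjc ((u : L2fun mu) z.1) * (M : L2fun mu2) z * (v : L2fun mu) z.2.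
have Fi u v : cintegrable mu2 (F u v).
  have := inL2_mul (L2funP (tens u v)) (L2funP M).
  congr cintegrable; apply/funext => z; rewrite -[tens u v z]/(_ * _) rmorphM/= conjcK.
  by rewrite /F mulrAC.
rewrite -[LHS]/(cintegral mu2 (F f g)) -[X in conjc X]/(cintegral mu2 (F g f)).
rewrite -cintegralJ// -(cintegral_swap (cintegrableJ (Fi g f))).
apply: ae_eq_cintegral.
- exact: cintegrable_measurable (Fi f g).
- apply: cmeasurableJ; apply: cintegrable_measurable; exact: cintegrable_swap (Fi g f).
- apply: filterS Msa => z Mz; rewrite /F /= Mz !rmorphM/= !conjcK.
  by rewrite mulrAC [RHS]mulrC mulrA.
Qed.

End tensor.

(** * Cut norm and operator norm *)

Section truncated_functions.
Context d (T : measurableType d) (R : realType).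
Variable mu : {measure set T -> \bar R}.
Hypothesis mu1 : mu [set: T] = 1%E.
Local Notation H := (L2 mu1).
Implicit Types (f : H) (L : R).

(** Large values are set to 0 rather than scaled down; as a product with an indicator the result is
    clearly measurable. *)
Definition cutoff L (f : T -> R[i]) x := f x * rc (\1_[set y | modulus (f y) <= L] x).

Lemma cutoffE L (f : T -> R[i]) x :
  cutoff L f x = if modulus (f x) <= L then f x else 0.
Proof.
rewrite /cutoff indicE; case: ifPn => fx.
  by rewrite mem_set// rc1 mulr1.
by rewrite memNset ?rc0 ?mulr0//=; exact/negP.
Qed.

Lemma modulus_cutoff_le L (f : T -> R[i]) x : modulus (cutoff L f x) <= modulus (f x).
Proof.
by rewrite cutoffE; case: ifP; rewrite ?ComplexField.Normc.normc0 ?modulus_ge0.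
Qed.

Lemma modulus_cutoff_bound L (f : T -> R[i]) x : 0 <= L -> modulus (cutoff L f x) <= L.
Proof. by move=> L0; rewrite cutoffE; case: ifPn; rewrite ?ComplexField.Normc.normc0. Qed.

Lemma cmeasurable_cutoff L (f : T -> R[i]) : cmeasurable f -> cmeasurable (cutoff L f).
Proof.
move=> mf; apply: cmeasurableM => //; apply: cmeasurable_indic.
have := measurable_fun_ler (cmeasurable_modulus mf) (@measurable_cst _ _ T R setT L).
move=> /(_ measurableT [set true]); rewrite setTI; apply.
by [].
Qed.

Lemma inL2_cutoff L (f : T -> R[i]) : inL2 mu f -> inL2 mu (cutoff L f).
Proof.
move=> /inL2P[mf fi]; apply/inL2P; split; first exact: cmeasurable_cutoff.
apply: rintegrable_le fi.
  exact/measurable_funX/cmeasurable_modulus/cmeasurable_cutoff.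
by move=> x; rewrite ger0_norm ?sqr_ge0// lerXn2r ?nnegrE ?modulus_ge0// modulus_cutoff_le.
Qed.

Definition trunc_fun L f : H := mkL2 (inL2_cutoff L (L2funP f)).

Definition nrm1 f : R := \int[mu]_x modulus ((f : L2fun mu) x).

Lemma modulus_integrable f : mu.-integrable [set: T]
  (EFin \o (fun x => modulus ((f : L2fun mu) x))).
Proof. by apply: rintegrable_modulus; apply: (inL2_cintegrable mu1); exact: L2funP. Qed.

Lemma sqr_modulus_integrable f : mu.-integrable [set: T]
  (EFin \o (fun x => modulus ((f : L2fun mu) x) ^+ 2)).
Proof. by have /inL2P[] := L2funP f. Qed.

Lemma nrm1_ge0 f : 0 <= nrm1 f.
Proof. by apply: Rintegral_ge0 => x _; exact: modulus_ge0. Qed.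

Lemma nrm1_le1 f : nrm f = 1 -> nrm1 f <= 1.
Proof.
move=> f1; have ci : mu.-integrable [set: T] (EFin \o (fun _ : T => 2^-1 : R)).
  apply/integrableP; split; first exact/measurable_EFinP/measurable_cst.
  by rewrite [ltLHS](integral_cst mu measurableT `|(2^-1)%:E|%E) mu1 mule1 ltry.
have si := rintegrableZ 2^-1 (sqr_modulus_integrable f).
apply: (@le_trans _ _ (\int[mu]_x (2^-1 * modulus ((f : L2fun mu) x) ^+ 2 + 2^-1))).
  apply: le_Rintegral => //; [exact: modulus_integrable|exact: rintegrableD|].
  move=> x _; rewrite -subr_ge0.
  by have := sqr_ge0 (modulus ((f : L2fun mu) x) - 1); rewrite sqrrB1; lra.
rewrite RintegralD// RintegralZl//; last exact: sqr_modulus_integrable.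
by rewrite -sqn_L2 -sqr_nrm f1 expr1n Rintegral_cst// mu1/=; lra.
Qed.

Lemma nrm_trunc_fun L f : nrm (trunc_fun L f) <= nrm f.
Proof.
rewrite ler_sqrt ?sqn_ge0// !sqn_L2; apply: le_Rintegral => //.
- exact: sqr_modulus_integrable.
- exact: sqr_modulus_integrable.
- by move=> x _; rewrite lerXn2r ?nnegrE ?modulus_ge0// modulus_cutoff_le.
Qed.

Lemma nrm1_trunc_fun L f : nrm1 (trunc_fun L f) <= nrm1 f.
Proof.
apply: le_Rintegral => //; [exact: modulus_integrable|exact: modulus_integrable|].
by move=> x _; exact: modulus_cutoff_le.
Qed.

(** Where the difference is nonzero, [|f| > L] and hence [|f| <= |f|^2 / L]. *)
Lemma nrm1_truncB L f : 0 < L -> nrm1 (f - trunc_fun L f) <= sqn f / L.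
Proof.
move=> L0; rewrite sqn_L2 mulrC -RintegralZl//; last exact: sqr_modulus_integrable.
apply: le_Rintegral => //.
- exact: modulus_integrable.
- by apply: rintegrableZ; exact: sqr_modulus_integrable.
move=> x _; rewrite -[(f - _) x]/((f : L2fun mu) x - cutoff L (f : L2fun mu) x) cutoffE.
case: ifPn => [_|].
  by rewrite subrr ComplexField.Normc.normc0 mulr_ge0 ?sqr_ge0 ?invr_ge0 ?(ltW L0).
rewrite -ltNge subr0 => Lf; rewrite mulrC ler_pdivlMr// expr2 ler_wpM2l ?modulus_ge0//.
exact: ltW.
Qed.

(** At each point the cutoff eventually equals [f], and [|f|^2] dominates the squared
    differences. *)
Lemma trunc_fun_cvg f : hcvg (fun n => trunc_fun n%:R f) f.
Proof.
apply: hcvg_sqn.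
have : (\int[mu]_x (modulus ((trunc_fun n%:R f - f : L2fun mu) x) ^+ 2)%:E)%E @[n --> \oo] -->
    (\int[mu]_(x in [set: T]) (cst 0 x))%E.
  apply: (@dominated_cvg _ _ _ mu _ measurableT
    (fun n x => (modulus ((trunc_fun n%:R f - f : L2fun mu) x) ^+ 2)%:E) (cst 0%E)
    (fun x => (modulus ((f : L2fun mu) x) ^+ 2)%:E)).
  - by move=> n; have /integrableP[] := sqr_modulus_integrable (trunc_fun n%:R f - f).
  - move=> x _; apply: cvg_near_cst.
    exists (Num.bound (modulus ((f : L2fun mu) x))) => // n /= bn.
    change ((modulus (cutoff n%:R (f : L2fun mu) x - (f : L2fun mu) x) ^+ 2)%:E = 0%E).
    rewrite cutoffE.
    rewrite ifT ?subrr ?ComplexField.Normc.normc0 ?expr0n//.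
    have := archi_boundP (modulus_ge0 ((f : L2fun mu) x)) => /ltW/le_trans; apply.
    by rewrite ler_nat.
  - by [].
  - exact: sqr_modulus_integrable.
  - move=> n x _; rewrite lee_fin ger0_norm ?sqr_ge0// lerXn2r ?nnegrE ?modulus_ge0//.
    change (modulus (cutoff n%:R (f : L2fun mu) x - (f : L2fun mu) x) <=
      modulus ((f : L2fun mu) x)); rewrite cutoffE.
    case: ifP => _; first by rewrite subrr ComplexField.Normc.normc0 modulus_ge0.
    by rewrite sub0r modulusN.
rewrite integral0 => h.
suff : EFin \o (fun n => sqn (trunc_fun n%:R f - f)) @ \oo --> 0%E by move=> /fine_cvgP[].
rewrite (_ : EFin \o _ = fun n => (\int[mu]_x
    (modulus ((trunc_fun n%:R f - f : L2fun mu) x) ^+ 2)%:E)%E)//.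
apply/funext => n /=; rewrite sqn_L2 EFin_Rintegral//.
exact: sqr_modulus_integrable.
Qed.

End truncated_functions.

Section cut_norms.
Context d (V : measurableType d) (R : realType) (mu : probability V R).
Local Notation mu2 := (mu \x mu)%E.
Local Notation muT := (probability_setT mu).
Local Notation H := (L2 muT).
Local Notation HH := (L2 (mu2T mu)).
Implicit Types (f g : H) (D M K : HH).

Let tP := tens_is_tensor mu.

(** The test functions are bounded everywhere rather than almost everywhere. They are admissible in
    the cut norm, and rescaled cutoffs are of this kind. *)
Definition unit_ball_bound D (k : R) := forall f g : H,
  (forall x, modulus ((f : L2fun mu) x) <= 1) ->
  (forall x, modulus ((g : L2fun mu) x) <= 1) ->
  modulus (sform (@tens _ _ _ mu) D f g) <= k.

Lemma opbound_unit D (c : R) : 0 <= c ->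
  (forall f g, nrm f = 1 -> nrm g = 1 -> modulus (sform (@tens _ _ _ mu) D f g) <= c) ->
  opbound (@tens _ _ _ mu) D c.
Proof.
move=> c0 h f g.
have [f0|f0] := eqVneq (nrm f) 0.
  rewrite f0 mul0r mulr0 (le_trans (modulus_ip _ _))// nrm_tensor// f0 !mul0r.
  by [].
have [g0|g0] := eqVneq (nrm g) 0.
  by rewrite g0 !mulr0 (le_trans (modulus_ip _ _))// nrm_tensor// g0 mulr0 mul0r.
have := h _ _ (nrm_normalize f0) (nrm_normalize g0).
rewrite (sformZl tP) (sformZr tP) rcJ !modulusM !modulus_rc !ger0_norm ?invr_ge0 ?nrm_ge0//.
by rewrite mulrA -invfM mulrC ler_pdivrMr// mulr_gt0// lt_neqAle eq_sym ?f0 ?g0 nrm_ge0.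
Qed.

Lemma sform_le_nrm1 D (B : R) f g : 0 <= B ->
  (\forall z \ae mu2, modulus ((D : L2fun mu2) z) <= B) ->
  modulus (sform (@tens _ _ _ mu) D f g) <= 2 * (B * (nrm1 f * nrm1 g)).
Proof.
move=> B0 DB.
have i_h : cintegrable mu2 (fun z => conjc ((tens f g : L2fun mu2) z) * (D : L2fun mu2) z).
  by apply: inL2_mul; exact: L2funP.
apply: le_trans (modulus_cintegral_le i_h) _; rewrite ler_pM2l//.
have ifg := rintegrable_prod (modulus_integrable f) (modulus_integrable g).
rewrite /nrm1 -Rintegral_prod; try exact: modulus_integrable.
rewrite -RintegralZl// -lee_fin !EFin_Rintegral//; last first.
- exact: rintegrable_modulus.
- exact: rintegrableZ.
apply: ae_ge0_le_integral => //.
- by move=> z _; rewrite lee_fin modulus_ge0.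
- by have /integrableP[] := rintegrable_modulus i_h.
- by move=> z _; rewrite lee_fin !mulr_ge0 ?modulus_ge0.
- by have /integrableP[] := rintegrableZ B ifg.
- apply: filterS DB => z Dz _; rewrite lee_fin modulusM modulusJ mulrC.
  by rewrite -[tens f g z]/(_ * _) [modulus (_ * _)]modulusM modulusJ
    ler_wpM2r// mulr_ge0 ?modulus_ge0.
Qed.

(* Split both arguments at height [L]: the bounded parts are controlled by the
   cut norm, the rest has small [L_1] norm. *)
Lemma opbound_of_unit_ball D (B k L : R) : 0 <= B -> 0 <= k -> 0 < L ->
  (\forall z \ae mu2, modulus ((D : L2fun mu2) z) <= B) -> unit_ball_bound D k ->
  opbound (@tens _ _ _ mu) D (L ^+ 2 * k + 4 * B / L).
Proof.
move=> B0 k0 L0 DB Dk; apply: opbound_unit.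
  by rewrite addr_ge0// ?mulr_ge0 ?sqr_ge0 ?invr_ge0 ?(ltW L0).
move=> f g f1 g1; set f' := trunc_fun L f; set g' := trunc_fun L g.
have -> : sform (@tens _ _ _ mu) D f g = sform (@tens _ _ _ mu) D f' g' +
    (sform (@tens _ _ _ mu) D f' (g - g') + sform (@tens _ _ _ mu) D (f - f') g).
  rewrite addrA -(sformDr tP) [g' + _]addrC subrK -(sformDl tP).
  by rewrite [f' + _]addrC subrK.
apply: le_trans (modulusD _ _) _; apply: lerD.
  have small (h : H) x : modulus ((rc L^-1 *: trunc_fun L h : L2fun mu) x) <= 1.
    change (modulus (rc L^-1 * cutoff L (h : L2fun mu) x) <= 1).
    rewrite modulusM modulus_rc.
    rewrite ger0_norm ?invr_ge0 ?(ltW L0)// mulrC ler_pdivrMr// mul1r.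
    by rewrite modulus_cutoff_bound// ltW.
  have := Dk _ _ (small f) (small g).
  rewrite (sformZl tP) (sformZr tP) rcJ !modulusM !modulus_rc !ger0_norm ?invr_ge0 ?(ltW L0)//.
  by rewrite mulrA -invfM mulrC ler_pdivrMr ?mulr_gt0// mulrC -expr2.
have Bb (a b : R) : 0 <= a -> 0 <= b -> a <= 1 -> b <= 1 / L -> 2 * (B * (a * b)) <= 2 * B / L.
  move=> a0 b0 a1 bL; rewrite -mulrA ler_pM2l// ler_wpM2l//.
  by apply: le_trans (ler_piMl b0 a1) _; rewrite -[leRHS]mul1r.
(* Each of the two remaining terms has one argument of [L_1] norm at most 1 and the other at most
   [1 / L]. *)
have -> : 4 * B / L = 2 * B / L + 2 * B / L by ring.
have f1' := nrm1_le1 f1; have g1' := nrm1_le1 g1.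
have truncB (h : H) : nrm h = 1 -> nrm1 (h - trunc_fun L h) <= 1 / L.
  by move=> h1; have := nrm1_truncB h L0; rewrite -sqr_nrm h1 expr1n.
apply: le_trans (modulusD _ _) _; apply: lerD.
  apply: le_trans (sform_le_nrm1 _ _ B0 DB) _; apply: Bb; rewrite ?nrm1_ge0//.
    exact: le_trans (nrm1_trunc_fun _ _) f1'.
  exact: truncB.
apply: le_trans (sform_le_nrm1 _ _ B0 DB) _; rewrite [nrm1 (f - _) * _]mulrC.
by apply: Bb; rewrite ?nrm1_ge0//; exact: truncB.
Qed.

(** [K] need not be bounded, so the comparison of norms is made for [M i - M j]. For fixed bounded
    arguments [j] goes to infinity, and arbitrary arguments are then approximated in [L_2] by their
    cutoffs. *)
Lemma op_cvg_of_unit_ball (M : nat -> HH) K :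
  (forall i, \forall z \ae mu2, modulus ((M i : L2fun mu2) z) <= 1) ->
  (forall k : R, 0 < k -> exists i0, forall i, (i0 <= i)%N -> unit_ball_bound (M i - K) k) ->
  op_cvg (@tens _ _ _ mu) M K.
Proof.
(* With the bound 2 for [M i - M j] and cut bound [k + k], these values make both [L ^+ 2 * (k + k)]
   and [4 * 2 / L] equal to [eta / 2]. *)
move=> M1 MK eta eta0; pose L := 16 / eta.
have L0 : 0 < L by rewrite divr_gt0.
pose k := eta / (4 * L ^+ 2).
have k0 : 0 < k by rewrite divr_gt0// mulr_gt0// exprn_gt0.
have [i0 i0P] := MK k k0; exists i0 => i ii0.
have cauchy j : (i0 <= j)%N -> opbound (@tens _ _ _ mu) (M i - M j) eta.
  move=> ij0.
  have -> : eta = L ^+ 2 * (k + k) + 4 * 2 / L.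
    by rewrite /k /L; field; rewrite gt_eqF.
  apply: opbound_of_unit_ball => //; first by rewrite addr_ge0// ltW.
    apply: filterS2 (M1 i) (M1 j) => z Mi Mj.
    change (modulus ((M i : L2fun mu2) z - (M j : L2fun mu2) z) <= 2).
    by rewrite (le_trans (modulusD _ _))// modulusN; lra.
  move=> f g f1 g1; have -> : M i - M j = (M i - K) - (M j - K) by rewrite opprB addrA subrK.
  by rewrite sformB (le_trans (modulusD _ _))// modulusN lerD//; [exact: i0P|exact: i0P].
(* Divided by [L'], the arguments become test functions, so for large [j] the kernel [M j - K]
   contributes at most [e], whatever [e] is. *)
have bounded f g (L' : R) : 0 < L' -> (forall x, modulus ((f : L2fun mu) x) <= L') ->
    (forall x, modulus ((g : L2fun mu) x) <= L') ->
    modulus (sform (@tens _ _ _ mu) (M i - K) f g) <= eta * (nrm f * nrm g).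
  move=> L'0 fL gL; apply/ler_addgt0Pr => e e0.
  have e'0 : 0 < e / L' ^+ 2 by rewrite divr_gt0// exprn_gt0.
  have [j0 j0P] := MK _ e'0; pose j := maxn i0 j0.
  have -> : M i - K = (M i - M j) + (M j - K) by rewrite addrA subrK.
  rewrite sformD (le_trans (modulusD _ _))// lerD//; first by apply: cauchy; exact: leq_maxl.
  have small (h : H) : (forall x, modulus ((h : L2fun mu) x) <= L') ->
      forall x, modulus ((rc L'^-1 *: h : L2fun mu) x) <= 1.
    move=> hL x; change (modulus (rc L'^-1 * (h : L2fun mu) x) <= 1).
    by rewrite modulusM modulus_rc ger0_norm ?invr_ge0 ?(ltW L'0)// mulrC ler_pdivrMr// mul1r.
  have := j0P j (leq_maxr _ _) _ _ (small f fL) (small g gL).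
  rewrite (sformZl tP) (sformZr tP) rcJ !modulusM !modulus_rc !ger0_norm ?invr_ge0 ?(ltW L'0)//.
  by rewrite mulrA -invfM mulrC -expr2 ler_pM2r// invr_gt0 exprn_gt0.
move=> f g; rewrite -subr_le0.
pose D := M i - K.
apply: (@null_seq_ge _ _ (fun n => nrm D * (nrm f * nrm (trunc_fun n%:R g - g) +
    nrm (trunc_fun n%:R f - f) * nrm g))); last first.
  have sh (h : H) : null_seq (fun n => nrm (trunc_fun n%:R h - h)).
    exact: (trunc_fun_cvg h).
  by apply: null_seqZ; apply: null_seqD; [exact/null_seqZ/sh|exact/null_seqZr/sh].
move=> n; set f' := trunc_fun _ f; set g' := trunc_fun _ g.
have -> : sform (@tens _ _ _ mu) D f g = sform (@tens _ _ _ mu) D f' g' +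
    (sform (@tens _ _ _ mu) D f' (g - g') + sform (@tens _ _ _ mu) D (f - f') g).
  rewrite addrA -(sformDr tP) [g' + _]addrC subrK -(sformDl tP).
  by rewrite [f' + _]addrC subrK.
rewrite lerBlDr [leRHS]addrC (le_trans (modulusD _ _))// lerD//.
  apply: (@le_trans _ _ (eta * (nrm f' * nrm g'))).
    (* The bound is [n + 1] and not [n], because [bounded] asks for a positive height and [n] may be
       0. *)
    have small (h : H) x : modulus ((trunc_fun n%:R h : L2fun mu) x) <= n.+1%:R.
      apply: (@le_trans _ _ n%:R); last by rewrite ler_nat.
      by apply: modulus_cutoff_bound.
    exact: (bounded f' g' n.+1%:R (ltr0Sn _ _) (small f) (small g)).
  by rewrite ler_pM2l// ler_pM ?nrm_ge0 ?nrm_trunc_fun.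
rewrite mulrDr (le_trans (modulusD _ _))// lerD//.
  rewrite (le_trans (opbound_nrm tP _ _ _))// ler_wpM2l ?nrm_ge0// nrmBC.
  by rewrite ler_wpM2r ?nrm_ge0 ?nrm_trunc_fun.
by rewrite (le_trans (opbound_nrm tP _ _ _))// nrmBC.
Qed.

End cut_norms.

(** * Kernel truncations *)

Section kernel_truncations.
Context d (V : measurableType d) (R : realType) (mu : probability V R).
Local Notation mu2 := (mu \x mu)%E.
Local Notation H := (L2 (probability_setT mu)).
Local Notation HH := (L2 (mu2T mu)).
Local Notation t := (@tens _ _ _ mu).
Implicit Types (M N K : HH).

Let tP := tens_is_tensor mu.

Lemma L2_sumE (I : Type) (r : seq I) (P : pred I) (F : I -> HH) z :
  ((\sum_(i <- r | P i) F i : HH) : L2fun mu2) z =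
  \sum_(i <- r | P i) (F i : L2fun mu2) z.
Proof. by elim/big_rec2: _ => // i y1 y2 _ <-. Qed.

Lemma spectral_sumE (P : pred nat) (l : nat -> R) (e : nat -> H) n :
  spectral_sum P l (fun k => e k : L2fun mu) n = (spec_sum t P l e n : L2fun mu2).
Proof. by apply/funext => z; rewrite L2_sumE. Qed.

Lemma orthonormalE (I : pred nat) (e : nat -> H) :
  Defs.orthonormal mu I (fun k => e k : L2fun mu) <-> ON I e.
Proof.
split=> [[_ h] k l Ik Il|h]; first exact: h.
by split=> [k _|k l Ik Il]; [exact: L2funP|exact: h].
Qed.

Lemma is_trunc_is_truncation M N (a : R) : is_trunc t M a N ->
  is_truncation mu (M : L2fun mu2) a (N : L2fun mu2).
Proof.
move=> [I [l [e [[eON eM] eN]]]]; exists I, l, (fun k => e k : L2fun mu).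
split; first split.
- exact/orthonormalE.
- have := (L2cvg_hcvg (spec_sum t I l e) M).2 eM.
  by congr L2cvg; apply/funext => n; rewrite spectral_sumE.
- have := (L2cvg_hcvg (spec_sum t (fun k => I k && (a < `|l k|)) l e) N).2 eN.
  by congr L2cvg; apply/funext => n; rewrite spectral_sumE.
Qed.

Lemma is_truncation_is_trunc M N (a : R) :
  is_truncation mu (M : L2fun mu2) a (N : L2fun mu2) -> is_trunc t M a N.
Proof.
move=> [I [l [f [[fON fM] fN]]]].
(* Outside [I] nothing is known about [f k], so it is replaced by 0 when it is not square
   integrable. *)
pose e k : H := if pselect (inL2 mu (f k)) is left h then mkL2 h else 0.
have eE k : I k -> (e k : L2fun mu) = f k :> (V -> R[i]).
  move=> Ik; rewrite /e; case: pselect => // h.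
  by have [/(_ _ Ik)] := fON.
have sumE (P : pred nat) n : (forall k, P k -> I k) ->
    spectral_sum P l f n = (spec_sum t P l e n : L2fun mu2).
  move=> PI; rewrite -spectral_sumE; apply/funext => z.
  by apply: eq_bigr => k /PI Ik; rewrite eE.
exists I, l, e; split; first split.
- move=> k j Ik Ij; have [_ /(_ k j Ik Ij) <-] := fON.
  rewrite -(eE k Ik) -(eE j Ij).
  by [].
- apply/L2cvg_hcvg; move: fM; congr L2cvg; apply/funext => n; exact: sumE.
- apply/L2cvg_hcvg; move: fN; congr L2cvg; apply/funext => n.
  by apply: sumE => k /andP[].
Qed.

(** The spectral theorem provides a truncation, so the choice made by [xget] is one and not the
    default value. *)
Lemma truncation_is_trunc M (a : R) : hermitian_kernel t M ->
  exists N, is_trunc t M a N /\ truncation mu (M : L2fun mu2) a = (N : L2fun mu2).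
Proof.
move=> hM; have [N0 tN0] := is_trunc_ex tP a hM.
have : is_truncation mu (M : L2fun mu2) a (truncation mu (M : L2fun mu2) a).
  apply: (@xgetPex _ (fun=> 0) [set N | is_truncation mu (M : L2fun mu2) a N]).
  by exists (l2val (N0 : L2fun mu2)); exact: is_trunc_is_truncation.
set N := truncation _ _ _ => tN.
have NL : inL2 mu2 N by have [I [l [f [_ []]]]] := tN.
by exists (mkL2 NL); split=> //; exact: is_truncation_is_trunc.
Qed.

Lemma cut_norm_ge0 (D : V * V -> R[i]) : (0 <= cut_norm mu D)%E.
Proof.
apply: (@le_trans _ _ (modulus (Defs.sesqui mu (fun=> 0) D (fun=> 0)))%:E).
  by rewrite lee_fin modulus_ge0.
apply: ereal_sup_ubound; exists (fun=> 0), (fun=> 0); split=> //.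
- apply: (cLnormy_ge (probability_setT mu)) => x.
  by rewrite ComplexField.Normc.normc0.
- apply: (cLnormy_ge (probability_setT mu)) => x.
  by rewrite ComplexField.Normc.normc0.
Qed.

(** On a probability space the [L_2] norm is at most the essential supremum. *)
Lemma cut_norm_le_opbound M (c : R) : 0 <= c -> opbound t M c ->
  (cut_norm mu (M : L2fun mu2) <= c%:E)%E.
Proof.
move=> c0 Mc; apply: ub_ereal_sup => _ [f [g [mf mg f1 g1 ->]]].
have /(cLnormy_le (probability_setT mu)) {}f1 := f1.
have /(cLnormy_le (probability_setT mu)) {}g1 := g1.
have fL := inL2_bounded (probability_setT mu) mf ler01 f1.
have gL := inL2_bounded (probability_setT mu) mg ler01 g1.
pose f' : H := mkL2 fL; pose g' : H := mkL2 gL.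
have -> : Defs.sesqui mu f (M : L2fun mu2) g = sform t M f' g' by exact: (sesqui_sform f' g').
rewrite lee_fin (le_trans (Mc _ _))// ler_piMr// mulr_ile1 ?nrm_ge0//.
  exact: nrm_bounded.
exact: nrm_bounded.
Qed.

Lemma unit_ball_bound_cut_norm M (k : R) : (cut_norm mu (M : L2fun mu2) <= k%:E)%E ->
  unit_ball_bound M k.
Proof.
move=> h f g f1 g1; rewrite -lee_fin; apply: le_trans h.
apply: ereal_sup_ubound; exists (l2val (f : L2fun mu)), (l2val (g : L2fun mu)); split.
- by have /inL2P[] := L2funP f.
- by have /inL2P[] := L2funP g.
- exact: (cLnormy_ge (probability_setT mu)).
- exact: (cLnormy_ge (probability_setT mu)).
- by rewrite sesqui_sform.
Qed.

Lemma cut_cvg_op_cvg (M : nat -> HH) K :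
  (forall i, \forall z \ae mu2, modulus ((M i : L2fun mu2) z) <= 1) ->
  cut_cvg mu (fun i => M i : L2fun mu2) (K : L2fun mu2) <-> op_cvg t M K.
Proof.
move=> M1; split=> [[_ /fine_cvgP[fin h]]|h].
  apply: op_cvg_of_unit_ball => // k k0.
  have /null_seqP/(_ _ k0)[i0 i0P] := h.
  have [i1 _ i1P] := fin; exists (maxn i0 i1) => i; rewrite geq_max => /andP[ii0 ii1].
  apply: unit_ball_bound_cut_norm; rewrite -(fineK (i1P i ii1)) lee_fin.
  exact: le_trans (ler_norm _) (ltW (i0P i ii0)).
split; first exact: L2funP.
have le_eta (eta : R) : 0 < eta -> exists i0, forall i, (i0 <= i)%N ->
    (cut_norm mu (fun z => (M i : L2fun mu2) z - (K : L2fun mu2) z)%R <= eta%:E)%E.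
  move=> eta0; have [i0 i0P] := h _ eta0; exists i0 => i /i0P.
  by move/(cut_norm_le_opbound (ltW eta0)).
apply/fine_cvgP; split.
  have [i0 i0P] := le_eta _ ltr01; exists i0 => // i /i0P Mi.
  by rewrite ge0_fin_numE ?cut_norm_ge0// (le_lt_trans Mi)// ltry.
apply/null_seqP => e e0; have e2 : 0 < e / 2 by rewrite divr_gt0.
have [i0 i0P] := le_eta _ e2; exists i0 => i /i0P Mi /=.
rewrite ger0_norm ?fine_ge0 ?cut_norm_ge0//.
apply: (@le_lt_trans _ _ (e / 2)); last by lra.
by rewrite -lee_fin fineK// ge0_fin_numE ?cut_norm_ge0// (le_lt_trans Mi)// ltry.
Qed.

Lemma op_cvg_unique (M : nat -> HH) K K' : op_cvg t M K -> op_cvg t M K' -> nrm (K - K') = 0.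
Proof.
move=> MK MK'; apply: (t_total tP) => f g; apply: modulus_eq0; apply/eqP.
rewrite eq_le modulus_ge0 andbT; apply/ler_addgt0Pr => e e0; rewrite add0r.
pose c := nrm f * nrm g + 1.
have fg0 : 0 <= nrm f * nrm g by rewrite mulr_ge0 ?nrm_ge0.
have c0 : 0 < c by rewrite ltr_wpDl.
have eta0 : 0 < e / 2 / c by rewrite !divr_gt0.
have [i0 h0] := MK _ eta0; have [i1 h1] := MK' _ eta0.
pose i := maxn i0 i1.
have -> : K - K' = (M i - K') - (M i - K) by rewrite opprB [_ + (K - _)]addrC addrA subrK.
rewrite ipBr (le_trans (modulusD _ _))// modulusN.
have := h0 i (leq_maxl _ _) f g; have := h1 i (leq_maxr _ _) f g.
rewrite /sform => le1 le0; apply: le_trans (lerD le1 le0) _.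
have : e / 2 / c * (nrm f * nrm g) <= e / 2.
  by rewrite mulrAC ler_pdivrMr// ler_pM2l ?divr_gt0// lerDl.
by lra.
Qed.

Lemma hermitian_op_cvg (M : nat -> HH) K : (forall i, hermitian_kernel t (M i)) ->
  op_cvg t M K -> hermitian_kernel t K.
Proof.
move=> hM MK f g; have M_h i : sform t (M i) f g = conjc (sform t (M i) g f) := hM i f g.
apply/eqP; rewrite -subr_eq0; apply/eqP/modulus_eq0/eqP.
rewrite eq_le modulus_ge0 andbT; apply/ler_addgt0Pr => e e0; rewrite add0r.
pose c := nrm f * nrm g + 1.
have fg0 : 0 <= nrm f * nrm g by rewrite mulr_ge0 ?nrm_ge0.
have c0 : 0 < c by rewrite ltr_wpDl.
have eta0 : 0 < e / 2 / c by rewrite !divr_gt0.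
have [i h] := MK _ eta0; have {h} Mi := h i (leqnn i).
have JB (x y : R[i]) : conjc (x - y) = conjc x - conjc y by exact: rmorphB.
have -> : sform t K f g - conjc (sform t K g f) =
    - sform t (M i - K) f g + conjc (sform t (M i - K) g f).
  by rewrite !sformB JB -(M_h i) opprB addrA subrK.
rewrite (le_trans (modulusD _ _))// modulusN modulusJ.
have := Mi g f; rewrite [nrm g * _]mulrC => le1; apply: le_trans (lerD (Mi f g) le1) _.
have : e / 2 / c * (nrm f * nrm g) <= e / 2.
  by rewrite mulrAC ler_pdivrMr// ler_pM2l ?divr_gt0// lerDl.
by lra.
Qed.

End kernel_truncations.

(** * The equivalence and the formula for the limit *)

Theorem proposition1p1 (R : realType) (d : measure_display)
  (V : measurableType d) (mu : probability V R)
  (hsep : separable_measure mu)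
  (M : nat -> (V * V)%type -> complex R)
  (hM : forall i : nat, unit_self_adjoint_kernel mu (M i)) :
  ((exists K : (V * V)%type -> complex R, cut_cvg mu M K) <->
   (exists alpha : nat -> R, thresholds alpha /\
      forall j : nat, exists N : (V * V)%type -> complex R,
        L2cvg (mu \x mu)%E
          (fun i => truncation mu (M i) (alpha j)) N)) /\
  (forall alpha : nat -> R, thresholds alpha ->
     forall N : nat -> (V * V)%type -> complex R,
       (forall j : nat,
          L2cvg (mu \x mu)%E
            (fun i => truncation mu (M i) (alpha j)) (N j)) ->
       forall K : (V * V)%type -> complex R, cut_cvg mu M K ->
         L2cvg (mu \x mu)%E N K).
Proof.
pose t := @tens _ _ _ mu; have tP : is_tensor t by exact: tens_is_tensor.
have ML i : inL2 (mu \x mu)%E (M i) by have [] := hM i.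
pose M' i : L2 (mu2T mu) := mkL2 (ML i).
have M'1 i : \forall z \ae (mu \x mu)%E, modulus ((M' i : L2fun (mu \x mu)%E) z) <= 1.
  by have [_ _ /(cLnormy_le (mu2T mu))] := hM i.
have M'h i : hermitian_kernel t (M' i).
  by apply: self_adjoint_hermitian; have [] := hM i.
have M'C i : sqn (M' i) <= 1.
  rewrite -sqr_nrm expr_le1 ?nrm_ge0//; exact: nrm_bounded.
have cutE (K : L2 (mu2T mu)) : cut_cvg mu M (K : L2fun _) <-> op_cvg t M' K.
  exact: (cut_cvg_op_cvg K M'1).
(* One square integrable representative for every index and threshold at once, the threshold being
   unknown at this point. *)
have /choice[T TP] : forall ia : nat * R, exists N : L2 (mu2T mu),
    is_trunc t (M' ia.1) ia.2 N /\ truncation mu (M ia.1) ia.2 = (N : L2fun (mu \x mu)%E).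
  by move=> [i a]; exact: truncation_is_trunc.
have truncE a : (fun i => truncation mu (M i) a) = (fun i => T (i, a) : L2fun (mu \x mu)%E).
  by apply/funext => i; have [_] := TP (i, a).
(* Serves both the implication from convergent truncations to cut norm convergence and the formula
   for the limit. *)
have limit alpha (N : nat -> L2 (mu2T mu)) : thresholds alpha ->
    (forall j, L2cvg (mu \x mu)%E (fun i => truncation mu (M i) (alpha j)) (N j : L2fun _)) ->
    exists K, hcvg N K /\ op_cvg t M' K.
  move=> thr NP; apply: (@op_cvg_of_is_trunc _ _ _ t tP M' 1 alpha
    (fun i j => T (i, alpha j))) => //.
    by move=> i j; have [] := TP (i, alpha j).
  by move=> j; apply/L2cvg_hcvg; rewrite -truncE.
split; first split.
- move=> [K MK]; have KL : inL2 (mu \x mu)%E K by case: MK.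
  have {}MK := (cutE (mkL2 KL)).1 MK.
  have [alpha [thr NP]] := is_trunc_cvg tP (hermitian_op_cvg M'h MK) M'C MK.
  exists alpha; split=> // j; have [N {}NP] := NP j.
  exists (l2val (N : L2fun _)); rewrite truncE; apply/L2cvg_hcvg; apply: NP => i.
  by have [] := TP (i, alpha j).
- move=> [alpha [thr /choice[N NP]]].
  have NL j : inL2 (mu \x mu)%E (N j) by case: (NP j).
  have [K [_ /cutE MK]] := limit alpha (fun j => mkL2 (NL j)) thr NP.
  by exists (l2val (K : L2fun _)).
- move=> alpha thr N NP K MK.
  have NL j : inL2 (mu \x mu)%E (N j) by case: (NP j).
  have KL : inL2 (mu \x mu)%E K by case: MK.
  have {}MK := (cutE (mkL2 KL)).1 MK.
  have [K' [NK' MK']] := limit alpha (fun j => mkL2 (NL j)) thr NP.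
  (* The given cut norm limit and the limit [K'] of the [N j] are both limits in operator norm, so
     they differ by a kernel of norm 0. *)
  have : hcvg (fun j => mkL2 (NL j) : L2 (mu2T mu)) (mkL2 KL).
    by apply: hcvg_congr NK'; exact: (op_cvg_unique MK' MK).
  by move=> /L2cvg_hcvg.
Qed.
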